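(* Let $\mathsf V$ be a monoidal pseudovariety of semigroups containing $\mathcal{L}\mathsf{Sl}$ and such that $\mathsf V=\mathsf V\ast\mathsf D$. If $\mathcal X$ and $\mathcal Y$ are flow equivalent irreducible subshifts, then $G_{\mathsf V}(\mathcal X)$ and $G_{\mathsf V}(\mathcal Y)$ are isomorphic profinite groups, and $\widetilde G_{\mathsf V}(\mathcal X)$ and $\widetilde G_{\mathsf V}(\mathcal Y)$ are isomorphic profinite groups.
   Context: Alphabets are finite nonempty sets; $A^+$ is the free semigroup on $A$. A pseudovariety of semigroups is a class of finite semigroups closed under subsemigroups, homomorphic images and finite direct products; it is monoidal if it is generated (as a pseudovariety) by a class of finite monoids. $\mathcal L\mathsf{Sl}$ is the class of finite semigroups $S$ such that $eSe$ is a semilattice (commutative, all elements idempotent) for every idempotent $e$ of $S$. $\mathsf D$ is the class of finite semigroups $S$ with $Se=\{e\}$ for every idempotent $e$ of $S$. $\mathsf V\ast\mathsf W$ is the least pseudovariety containing all semidirect products (for left actions) of an element of $\mathsf V$ with an element of $\mathsf W$. $\widehat F_{\mathsf V}(A)$ is the free pro-$\mathsf V$ semigroup on $A$, i.e. the inverse limit of the finite quotients of $A^+$ belonging to $\mathsf V$. If $\mathsf V\supseteq\mathcal L\mathsf{Sl}$, $A^+$ embeds in it as a dense subsemigroup of isolated points. A subshift of $A^{\mathbb Z}$ is a nonempty closed set $\mathcal X\subseteq A^{\mathbb Z}$ with $\sigma_A(\mathcal X)=\mathcal X$, where $\sigma_A((x_i)_i)=(x_{i+1})_i$. It is irreducible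 if some $x$ has $\{\sigma_A^n(x)\mid n\ge 1\}$ a dense subset of $\mathcal X$. $L(\mathcal X)\subseteq A^+$ is the set of nonempty finite words occurring in elements of $\mathcal X$. Two subshifts are conjugate if there is a homeomorphism between them commuting with the shift maps. Flow equivalence of subshifts (conjugacy of suspension flows up to a time change) is, by Parry and Sullivan, the equivalence relation on subshifts generated by conjugacy and symbol expansion. Symbol expansion: given $\mathcal X\subseteq A^{\mathbb Z}$, a letter $\alpha\in A$ and a letter $\diamond\notin A$, put $B=A\cup\{\diamond\}$ and let $\mathcal E\colon A^+\to B^+$ be the homomorphism with $\mathcal E(\alpha)=\alpha\diamond$ and $\mathcal E(a)=a$ for $a\in A\setminus\{\alpha\}$; the symbol expansion of $\mathcal X$ relative to $\alpha$ is the least subshift $\mathcal X'$ of $B^{\mathbb Z}$ with $\mathcal E(L(\mathcal X))\subseteq L(\mathcal X')$. The mirage $\mathcal M_{\mathsf V}(\mathcal X)$ is the set of $u\in\widehat F_{\mathsf V}(A)$ all of whose factors in $A^+$ belong to $L(\mathcal X)$. The shadow $\mathrm{Sha}_{\mathsf V}(\mathcal X)$ is the union of the $\mathcal J$-classes of $\widehat F_{\mathsf V}(A)$ that intersect the topological closure $\overline{L(\mathcal X)}$ of $L(\mathcal X)$ in $\widehat F_{\mathsf V}(A)$. If $\mathcal X$ is irreducible, then among the $\mathcal J$-classes contained in $\mathrm{Sha}_{\mathsf V}(\mathcal X)$ (resp. in $\mathcal M_{\mathsf V}(\mathcal X)$) there is a minimum one for the $\mathcal J$-order, denoted $J_{\mathsf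 V}(\mathcal X)$ (resp. $\widetilde J_{\mathsf V}(\mathcal X)$), and it is regular. $G_{\mathsf V}(\mathcal X)$ (resp. $\widetilde G_{\mathsf V}(\mathcal X)$) is the profinite group, unique up to isomorphism of profinite groups, isomorphic to all maximal subgroups of $\widehat F_{\mathsf V}(A)$ contained in $J_{\mathsf V}(\mathcal X)$ (resp. in $\widetilde J_{\mathsf V}(\mathcal X)$). *)

(* Defs.v *)
From HB Require Import structures.
From mathcomp Require Import all_boot all_order ssralg ssrnum ssrint.
From mathcomp Require Import all_classical topology.
From Stdlib Require Import Relation_Operators.

Set Implicit Arguments.
Unset Strict Implicit.
Unset Printing Implicit Defensive.

Local Open Scope classical_set_scope.
Local Open Scope quotient_scope.
Local Open Scope group_scope.

(* A finType may be empty.  The empty semigroup belongs to every (nonempty)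
   pseudovariety below, which affects neither the ordering and the product of
   pseudovarieties nor the quotients of A^+. *)
#[short(type="finSemigroupType")]
HB.structure Definition FinSemigroup := {S of Semigroup S & Finite S}.

HB.instance Definition _ (S T : finSemigroupType) := Semigroup.on (S * T)%type.

Definition surjective (S T : Type) (f : S -> T) := forall y, exists x, f x = y.

Definition semigroup_class := finSemigroupType -> Prop.

Definition subclass (V W : semigroup_class) := forall S, V S -> W S.

Record pseudovariety (V : semigroup_class) : Prop := {
  pv_sub : forall (S T : finSemigroupType) (f : {multiplicative S -> T}),
    injective f -> V T -> V S;
  pv_quo : forall (S T : finSemigroupType) (f : {multiplicative S -> T}),
    surjective f -> V S -> V T;
  pv_unit : forall S : finSemigroupType, #|S| = 1%N -> V S;
  pv_prod : forall S T : finSemigroupType,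
    V S -> V T -> V ((S * T)%type : finSemigroupType)
}.

Definition generated_pv (C : semigroup_class) : semigroup_class :=
  fun S => forall W, pseudovariety W -> subclass C W -> W S.

Definition is_monoid (S : finSemigroupType) :=
  exists e : S, left_id e *%g /\ right_id e *%g.

Definition monoidal (V : semigroup_class) :=
  exists C : semigroup_class,
    subclass C is_monoid /\ forall S, V S <-> generated_pv C S.

Definition idem (S : semigroupType) (e : S) := e * e = e.

Definition local_monoid (S : semigroupType) (e : S) : set S :=
  [set e * s * e | s in setT].

Definition semilattice_on (S : semigroupType) (E : set S) :=
  (forall x y, E x -> E y -> x * y = y * x) /\ (forall x, E x -> idem x).

Definition LSl : semigroup_class :=
  fun S => forall e : S, idem e -> semilattice_on (local_monoid e).

Definition DD : semigroup_class :=
  fun S => forall e : S, idem e -> [set s * e | s in setT] = [set e].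

Record left_action (S T : semigroupType) := LeftAction {
  act :> T -> S -> S;
  actM : forall t, {morph act t : x y / x * y};
  act_act : forall t u s, act (t * u) s = act t (act u s)
}.

Definition sdprod (S T : finSemigroupType) (a : left_action S T) : Type :=
  (S * T)%type.

Section SemidirectProduct.
Variables (S T : finSemigroupType) (a : left_action S T).

Definition sdprod_mul (x y : sdprod a) : sdprod a :=
  (x.1 * a x.2 y.1, x.2 * y.2).

Lemma sdprod_mulA : associative sdprod_mul.
Proof.
by move=> x y z; rewrite /sdprod_mul /= actM act_act !mulgA.
Qed.

HB.instance Definition _ := Finite.on (sdprod a).
HB.instance Definition _ := isSemigroup.Build (sdprod a) sdprod_mulA.

End SemidirectProduct.

Inductive semidirect_class (V W : semigroup_class) : semigroup_class :=
| SemidirectClass (S T : finSemigroupType) (a : left_action S T) of V S & W T :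
    semidirect_class V W (sdprod a : finSemigroupType).

Definition pv_semidirect (V W : semigroup_class) : semigroup_class :=
  generated_pv (semidirect_class V W).

Record word (A : choiceType) := Word {
  wseq :> seq A;
  _ : ~~ nilp wseq
}.

Section FreeSemigroup.
Variable A : choiceType.

HB.instance Definition _ := [isSub for @wseq A].
HB.instance Definition _ := [Choice of word A by <:].

Lemma word_cat_subproof (u v : word A) : ~~ nilp (u ++ v).
Proof. by case: u => -[]. Qed.

Definition word_mul (u v : word A) : word A := Word (word_cat_subproof u v).

Lemma word_mulA : associative word_mul.
Proof. by move=> u v w; apply: val_inj => /=; rewrite catA. Qed.

HB.instance Definition _ := isSemigroup.Build (word A) word_mulA.

Lemma letter_subproof (a : A) : ~~ nilp [:: a].
Proof. by []. Qed.

Definition letter (a : A) : word A := Word (letter_subproof a).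

End FreeSemigroup.

Section Substitution.
Variables (A B : choiceType) (f : A -> word B).

Lemma wbind_subproof (w : word A) : ~~ nilp (flatten [seq wseq (f a) | a <- w]).
Proof. by case: w => -[|a s] //= _; case: (f a) => -[]. Qed.

(* The homomorphism A^+ -> B^+ extending f *)
Definition wbind (w : word A) : word B := Word (wbind_subproof w).

Lemma wbind_mul : {morph wbind : u v / u * v}.
Proof. by move=> u v; apply: val_inj; rewrite /= map_cat flatten_cat. Qed.

HB.instance Definition _ := isMultiplicative.Build _ _ wbind wbind_mul.

End Substitution.

(* A finite quotient of A^+ in V, given by its kernel congruence *)
Definition is_vcong (V : semigroup_class) (A : choiceType) (r : rel (word A)) :=
  exists (S : finSemigroupType) (f : {multiplicative word A -> S}),
    [/\ V S, surjective f & forall u v, r u v = (f u == f v)].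

Record vcong (V : semigroup_class) (A : choiceType) := VCong {
  vcong_rel :> rel (word A);
  vcongP : is_vcong V vcong_rel
}.

HB.instance Definition _ (V : semigroup_class) (A : choiceType) :=
  gen_eqMixin (vcong V A).
HB.instance Definition _ (V : semigroup_class) (A : choiceType) :=
  gen_choiceMixin (vcong V A).

Section Quotient.
Variables (V : semigroup_class) (A : choiceType) (r : vcong V A).

Lemma vcong_refl : reflexive r.
Proof. by have [S [f [_ _ rE]]] := vcongP r; move=> u; rewrite rE. Qed.

Lemma vcong_sym : ssrbool.symmetric r.
Proof. by have [S [f [_ _ rE]]] := vcongP r; move=> u v; rewrite !rE eq_sym. Qed.

Lemma vcong_trans : ssrbool.transitive r.
Proof.
by have [S [f [_ _ rE]]] := vcongP r; move=> u v w; rewrite !rE => /eqP-> /eqP->.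
Qed.

Lemma vcongM u u' v v' : r u u' -> r v v' -> r (u * v) (u' * v').
Proof.
by have [S [f [_ _ rE]]] := vcongP r; rewrite !rE !gmulfM => /eqP-> /eqP->.
Qed.

Definition vcong_equiv := EquivRel r vcong_refl vcong_sym vcong_trans.

Definition quo : Type := {eq_quot vcong_equiv}.

HB.instance Definition _ := Choice.on quo.
HB.instance Definition _ := EqQuotient.on quo.

Definition quo_mul (x y : quo) : quo := \pi_quo (repr x * repr y).

Lemma quo_piP (u v : word A) : \pi_quo u = \pi_quo v <-> r u v.
Proof. by split=> [/eqmodP|ruv]; [|apply/eqmodP]. Qed.

Lemma repr_pi (u : word A) : r (repr (\pi_quo u)) u.
Proof. by apply/quo_piP; rewrite reprK. Qed.

Lemma quo_piM (u v : word A) : \pi_quo (u * v) = quo_mul (\pi_quo u) (\pi_quo v).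
Proof.
by apply/quo_piP; rewrite vcong_sym; apply: vcongM; exact: repr_pi.
Qed.

Lemma quo_mulA : associative quo_mul.
Proof.
move=> x y z; rewrite -[x]reprK -[y]reprK -[z]reprK.
move: (repr x) (repr y) (repr z) => u v w.
by rewrite -(quo_piM v w) -(quo_piM u) -(quo_piM u v) -(quo_piM _ w) mulgA.
Qed.

HB.instance Definition _ := isSemigroup.Build quo quo_mulA.

End Quotient.

Section FreeProfinite.
Variables (V : semigroup_class) (A : choiceType).

Definition quo_product : topologicalType :=
  prod_topology (fun r : vcong V A => discrete_topology (quo r)).

(* The canonical map A^+/r -> A^+/r', defined when r is contained in r', sends
   the class of w to the class of w. *)
Definition quo_limit : set quo_product :=
  [set x | forall r r' : vcong V A, subrel r r' ->
     \pi_(quo r') (repr (x r : quo r)) = x r'].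

Definition freepro : Type := set_type quo_limit.

HB.instance Definition _ := Topological.on freepro.

Definition freepro_proj (r : vcong V A) (x : freepro) : quo r := val x r.

Lemma quo_limit_mul (x y : freepro) :
  quo_limit (fun r => freepro_proj r x * freepro_proj r y).
Proof.
move=> r r' rr'; rewrite -[RHS]/(quo_mul _ _).
have xr' := set_mem (valP x) r r' rr'; have yr' := set_mem (valP y) r r' rr'.
rewrite /freepro_proj -xr' -yr' -quo_piM; apply/quo_piP/rr'.
exact: repr_pi.
Qed.

Definition freepro_mul (x y : freepro) : freepro :=
  exist (fun z => z \in quo_limit) _ (mem_set (quo_limit_mul x y)).

Lemma freepro_mulA : associative freepro_mul.
Proof.
move=> x y z; apply: val_inj; apply: functional_extensionality_dep => r.
exact: mulgA.
Qed.

HB.instance Definition _ := isSemigroup.Build freepro freepro_mulA.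

Lemma quo_limit_word (w : word A) :
  quo_limit (fun r => \pi_(quo r) w).
Proof. by move=> r r' rr'; apply/quo_piP/rr'; exact: repr_pi. Qed.

Definition freepro_word (w : word A) : freepro :=
  exist (fun z => z \in quo_limit) _ (mem_set (quo_limit_word w)).

End FreeProfinite.

Section Green.
Variable S : semigroupType.
Implicit Types (u v : S) (E J K G : set S).

(* None stands for the adjoined identity of S^1. *)
Definition lmul1 (x : option S) u := if x is Some s then s * u else u.
Definition rmul1 u (x : option S) := if x is Some s then u * s else u.

Definition factor v u := exists x y : option S, u = lmul1 x (rmul1 v y).

Definition Jle u v := factor v u.

Definition Jclass u : set S := [set v | Jle u v /\ Jle v u].

Definition is_Jclass J := exists u, J = Jclass u.

Definition Jclass_le J K := forall u v, J u -> K v -> Jle u v.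

Definition min_Jclass E J :=
  [/\ is_Jclass J, J `<=` E &
      forall K, is_Jclass K -> K `<=` E -> Jclass_le J K].

Definition subgroup G :=
  (forall x y, G x -> G y -> G (x * y)) /\
  exists e, [/\ G e, forall x, G x -> e * x = x /\ x * e = x &
                forall x, G x -> exists y, [/\ G y, x * y = e & y * x = e]].

Definition maximal_subgroup G :=
  subgroup G /\ forall H, subgroup H -> G `<=` H -> H = G.

End Green.

Definition homeo (S T : topologicalType) (E : set S) (F : set T)
    (f : S -> T) (g : T -> S) :=
  [/\ {within E, continuous f}, {within F, continuous g},
      set_fun E F f, set_fun F E g &
      {in E, cancel f g} /\ {in F, cancel g f}].

Definition profinite_iso (V : semigroup_class) (A B : choiceType)
    (G : set (freepro V A)) (H : set (freepro V B)) :=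
  exists f g, homeo G H f g /\ {in G &, {morph f : x y / x * y}}.

Definition biseq (A : choiceType) : topologicalType :=
  {ptws int -> discrete_topology A}.

Section Subshift.
Variable A : choiceType.
Implicit Types (X : set (biseq A)) (x : biseq A).

Definition sigma x : biseq A := fun i => x (i + 1)%R.

Definition is_subshift X := [/\ X !=set0, closed X & sigma @` X = X].

Definition irreducible X :=
  exists x, let O := [set iter n sigma x | n in [set n | (1 <= n)%N]] in
    O `<=` X /\ X `<=` closure O.

Definition language X : set (word A) :=
  [set w : word A | exists x (i : int),
     X x /\ wseq w = [seq (x (i + k%:Z)%R : A) | k <- iota 0 (size w)]].

End Subshift.

Record subshift := Subshift {
  alphabet : finType;
  points :> set (biseq alphabet);
  subshiftP : is_subshift points
}.
Arguments points : clear implicits.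

Definition conjugate (X Y : subshift) :=
  exists f g, homeo (points X) (points Y) f g /\
    forall x, points X x -> f (sigma x) = sigma (f x).

(* The new letter is None. *)
Definition expand (A : finType) (alpha : A) : word A -> word (option A) :=
  wbind (fun a => if a == alpha then letter (Some a) * letter None
                  else letter (Some a)).

Inductive symbol_expansion : subshift -> subshift -> Prop :=
| SymbolExpansion (A : finType) (alpha : A)
    (X : set (biseq A)) (Y : set (biseq (option A)))
    (sX : is_subshift X) (sY : is_subshift Y) of
    expand alpha @` language X `<=` language Y &
    (forall Z, is_subshift Z -> expand alpha @` language X `<=` language Z ->
       Y `<=` Z) :
    symbol_expansion (Subshift sX) (Subshift sY).

(* By the Parry-Sullivan theorem, this is conjugacy of the suspension flows
   up to a time change. *)
Definition flow_equivalent : subshift -> subshift -> Prop :=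
  clos_refl_sym_trans subshift
    (fun X Y => conjugate X Y \/ symbol_expansion X Y).

Section Invariants.
Variables (V : semigroup_class) (X : subshift).

Definition mirage : set (freepro V (alphabet X)) :=
  [set u | forall w, factor (freepro_word V w) u -> language X w].

Definition shadow : set (freepro V (alphabet X)) :=
  [set u | exists J, [/\ is_Jclass J, J u &
     J `&` closure (@freepro_word V _ @` language X) !=set0]].

(* G_V(X) is only defined up to isomorphism: each of the groups below is a
   representative of it, and likewise for its mirage analogue. *)
Definition shadow_group (G : set (freepro V (alphabet X))) :=
  exists J, [/\ min_Jclass shadow J, maximal_subgroup G & G `<=` J].

Definition mirage_group (G : set (freepro V (alphabet X))) :=
  exists J, [/\ min_Jclass mirage J, maximal_subgroup G & G `<=` J].

End Invariants.

Arguments mirage V X : clear implicits.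
Arguments shadow V X : clear implicits.
Arguments shadow_group V X G : clear implicits.
Arguments mirage_group V X G : clear implicits.

(* Main.v *)
Require Import Defs.
From HB Require Import structures.
From mathcomp Require Import all_boot all_order ssralg ssrnum ssrint.
From mathcomp Require Import all_classical topology.
From mathcomp Require Import zify.

(* The isomorphism is induced by a transduction.

   A flow equivalence generator X -> Y (a conjugacy, or a symbol expansion) is
   realised on words by a transducer [tau] with finite memory: a sliding block
   code reading only the past, respectively the substitution alpha |-> alpha <>
   and the map erasing it again.  The opposite generator is realised by a
   transducer [gam], and [gam] after [tau] is the identity up to a bounded delay.

   As V contains S^1 with S and V = V * D, the value in a semigroup of V of the
   output of a transducer with memory K is recognised by a semidirect product in
   V * D.  So transducers are uniformly continuous for the pro-V uniformity and
   extend to the free pro-V semigroups.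

   Let e be an idempotent in the minimum J-class attached to X and let Q be a long
   suffix of e.  Started with history Q, the extension of [tau] is a homomorphism
   theta on the maximal subgroup H_e, since every element of H_e also ends in Q;
   moreover theta e lies in the minimum J-class attached to Y.  The delay of
   [gam] after [tau] becomes a conjugation u |-> s u t with t s = e, which is an
   isomorphism of H_e onto another maximal subgroup; applying this to both
   composites shows that theta is an isomorphism.  Finally J-equivalent idempotents
   of a profinite semigroup have isomorphic maximal subgroups. *)

Set Implicit Arguments.
Unset Strict Implicit.
Unset Printing Implicit Defensive.
Local Open Scope classical_set_scope.
Local Open Scope quotient_scope.
Local Open Scope group_scope.

(** * Pseudovarieties *)

Section Adjoin.
Variable S : semigroupType.

(** The identity [None] is new even when [S] is a monoid, so a product equal to [None] has no factor
    from [S]. *)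
Definition adj1 : Type := option S.
HB.instance Definition _ := Choice.on adj1.

Definition adj_mul (x y : adj1) : adj1 :=
  match x, y with
  | Some a, Some b => Some (a * b)
  | None, _ => y
  | _, None => x
  end.

Lemma adj_mulA : associative adj_mul.
Proof. by move=> [a|] [b|] [c|] //=; rewrite mulgA. Qed.

HB.instance Definition _ := isSemigroup.Build adj1 adj_mulA.

Lemma adj_1mul (x : adj1) : (None : adj1) * x = x.
Proof. by []. Qed.

End Adjoin.

HB.instance Definition _ (S : finSemigroupType) :=
  Finite.copy (adj1 S) (option S).
HB.instance Definition _ (I : finType) (S : finSemigroupType) :=
  Semigroup.on {ffun I -> S}.

Fact unit_mulA : associative (fun _ _ : unit => tt). Proof. by []. Qed.
HB.instance Definition _ := isSemigroup.Build unit unit_mulA.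

Definition pack_multiplicative (S T : semigroupType) (f : S -> T)
    (fM : {morph f : x y / x * y}) : {multiplicative S -> T} :=
  HB.pack_for {multiplicative S -> T} f (isMultiplicative.Build S T f fM).

Section Pseudovariety.
Variable V : semigroup_class.
Hypothesis pvV : pseudovariety V.

Lemma pv_subM (S T : finSemigroupType) (f : S -> T) :
  {morph f : x y / x * y} -> injective f -> V T -> V S.
Proof. by move=> fM; apply: (pv_sub pvV (f := pack_multiplicative fM)). Qed.

Lemma pv_quoM (S T : finSemigroupType) (f : S -> T) :
  {morph f : x y / x * y} -> surjective f -> V S -> V T.
Proof. by move=> fM; apply: (pv_quo pvV (f := pack_multiplicative fM)). Qed.

Lemma pv_ffun (I : finType) (S : finSemigroupType) : V S -> V {ffun I -> S}.
Proof.
move=> VS.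
have VI n : V {ffun 'I_n -> S}.
  elim: n => [|n IHn].
    by apply: (pv_unit pvV); rewrite card_ffun card_ord expn0.
  pose f (x : {ffun 'I_n.+1 -> S}) := (x ord0, [ffun i => x (lift ord0 i)]).
  apply: (@pv_subM _ (S * {ffun 'I_n -> S})%type f).
  - move=> x y; rewrite /f ffunE; congr pair.
    by apply/ffunP => i; rewrite !ffunE.
  - move=> x y [e0 /ffunP e]; apply/ffunP => i.
    by case: (unliftP ord0 i) => [j ->|->//]; have := e j; rewrite !ffunE.
  - exact: (pv_prod pvV).
pose f (x : {ffun I -> S}) : {ffun 'I_#|I| -> S} := [ffun i => x (enum_val i)].
apply: (@pv_subM _ _ f) (VI _).
- by move=> x y; apply/ffunP => i; rewrite !ffunE.
- move=> x y /ffunP e; apply/ffunP => i.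
  by have := e (enum_rank i); rewrite !ffunE enum_rankK.
Qed.

Hypothesis LSlV : subclass LSl V.

Lemma pv_adj_unit (S : finSemigroupType) : (forall x y : S, x = y) -> V (adj1 S).
Proof.
move=> S1; have xx (x : adj1 S) : x * x = x.
  by case: x => // a; congr Some; exact: S1.
have xy (x y : adj1 S) : x * y = y * x.
  by case: x y => [a|] [b|] //; congr Some; exact: S1.
apply: LSlV => e _; split=> [x y _ _|x _]; [exact: xy|exact: xx].
Qed.

(** The semigroups whose [adj1] lies in [V] form a pseudovariety, so it suffices to treat the
    monoids generating [V]. For a monoid [M], [adj1 M] embeds in the product of [M] with the
    two-element semilattice [adj1 unit]. *)
Lemma pv_adj1 (S : finSemigroupType) : monoidal V -> V S -> V (adj1 S).
Proof.
case=> C [Cmon VC] VS.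
suff: pseudovariety (fun T => V (adj1 T)) /\
      subclass C (fun T => V (adj1 T)).
  by case=> W1 W2; have /VC gS := VS; exact: gS _ W1 W2.
split; first split.
- move=> T T' f finj; apply: (@pv_subM _ _ (omap f : adj1 T -> adj1 T')).
    by move=> [a|] [b|] //; congr Some; exact: gmulfM.
  by move=> [a|] [b|] // [] /finj ->.
- move=> T T' f fsurj; apply: (@pv_quoM _ _ (omap f : adj1 T -> adj1 T')).
    by move=> [a|] [b|] //; congr Some; exact: gmulfM.
  by move=> [b|]; [have [a <-] := fsurj b; exists (Some a)|exists None].
- move=> T T1; apply: pv_adj_unit => x y.
  by have /fintype1P[z Hz] : #|T| == 1%N by [rewrite T1]; rewrite Hz [RHS]Hz.
- move=> T T' VT VT'.
  pose f (x : adj1 (T * T')%type) : (adj1 T * adj1 T')%type :=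
    if x is Some (a, b) then (Some a, Some b) else (None, None).
  apply: (@pv_subM _ _ f); last exact: (pv_prod pvV).
    by move=> [[a b]|] [[c d]|].
  by move=> [[a b]|] [[c d]|] // [-> ->].
move=> M CM; have [e [e1 e2]] := Cmon _ CM.
have VM : V M by apply/VC => W _; exact.
pose f (x : adj1 M) : (M * adj1 unit)%type :=
  if x is Some a then (a, Some tt) else (e, None).
apply: (@pv_subM _ _ f).
- by move=> [a|] [b|] //=; congr pair; rewrite ?e1 ?e2.
- by move=> [a|] [b|] // [->].
- by apply: (pv_prod pvV) => //; apply: pv_adj_unit => -[] [].
Qed.

End Pseudovariety.

Section Image.
Variables (A : choiceType) (S : finSemigroupType) (f : {multiplicative word A -> S}).

Definition in_image (x : S) : bool := `[< exists w, f w = x >].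
Definition image_sg : Type := {x : S | in_image x}.

HB.instance Definition _ := Finite.on image_sg.
HB.instance Definition _ := SubType.on image_sg.

Lemma in_image_mul (x y : image_sg) : in_image (val x * val y).
Proof.
have /asboolP[u <-] := valP x; have /asboolP[v <-] := valP y.
by apply/asboolP; exists (u * v); rewrite gmulfM.
Qed.

Definition image_mul (x y : image_sg) : image_sg := Sub _ (in_image_mul x y).

Lemma image_mulA : associative image_mul.
Proof. by move=> x y z; apply: val_inj; rewrite /= mulgA. Qed.

HB.instance Definition _ := isSemigroup.Build image_sg image_mulA.

Lemma in_image_word w : in_image (f w).
Proof. by apply/asboolP; exists w. Qed.

Definition to_image (w : word A) : image_sg := Sub _ (in_image_word w).

Lemma to_imageM : {morph to_image : x y / x * y}.
Proof. by move=> x y; apply: val_inj; rewrite /= gmulfM. Qed.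

End Image.

Section Vcong.
Variable V : semigroup_class.
Hypothesis pvV : pseudovariety V.

(** Corestricting [f] to its image gives the surjectivity that a [vcong] asks for and keeps the
    kernel; the image lies in [V] as a subsemigroup of [S]. *)
Lemma vcong_of_hom (A : choiceType) (S : finSemigroupType) (f : word A -> S) :
  {morph f : x y / x * y} -> V S ->
  exists r : vcong V A, forall u v, r u v = (f u == f v).
Proof.
move=> fM VS; pose F := pack_multiplicative fM.
suff vF : is_vcong V (fun u v => f u == f v) by exists (VCong vF).
exists (image_sg F), (pack_multiplicative (@to_imageM _ _ F)); split.
- apply: (pv_subM pvV (f := fun x : image_sg F => val x)) VS => //.
- case=> x ix; have /asboolP[w wx] := ix.
  by exists w; apply: val_inj.
- by [].
Qed.

Lemma vcong_meet (A : choiceType) (r s : vcong V A) :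
  exists t : vcong V A, subrel t r /\ subrel t s.
Proof.
have [S [f [VS _ fE]]] := vcongP r; have [T [g [VT _ gE]]] := vcongP s.
have fgM : {morph (fun w => (f w, g w)) : x y / x * y}.
  by move=> x y; rewrite !gmulfM.
have [t tE] := vcong_of_hom (S := (S * T)%type) fgM (pv_prod pvV VS VT).
exists t; split=> u v; rewrite tE => /eqP[e1 e2].
  by rewrite fE e1.
by rewrite gE e2.
Qed.

Lemma vcong_top (A : choiceType) : exists r : vcong V A, True.
Proof.
have fM : {morph (fun _ : word A => tt) : x y / x * y} by [].
have V1 : V unit by apply: (pv_unit pvV); rewrite card_unit.
by have [r _] := vcong_of_hom fM V1; exists r.
Qed.

Lemma vcong_meets (A : choiceType) (I : eqType) (s : seq I) (P : I -> vcong V A -> Prop) :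
  (forall i, exists r, P i r) ->
  (forall i (r t : vcong V A), subrel t r -> P i r -> P i t) ->
  exists t, forall i, i \in s -> P i t.
Proof.
move=> Pex Psub; elim: s => [|i s [t IH]].
  by have [r _] := vcong_top A; exists r.
have [r Pr] := Pex i; have [t' [t'r t't]] := vcong_meet r t.
exists t' => j; rewrite inE => /predU1P[->|/IH]; first exact: Psub Pr.
exact: Psub.
Qed.

End Vcong.

(** * Transducers and recognition in V * D *)

Section LastN.
Variable A : Type.
Implicit Types (p q h w : seq A) (K : nat).

Definition lastn K h := drop (size h - K) h.

Lemma size_lastn K h : size (lastn K h) = minn K (size h).
Proof. by rewrite size_drop; lia. Qed.

Lemma lastn_split K h : h = take (size h - K) h ++ lastn K h.
Proof. by rewrite cat_take_drop. Qed.

Lemma lastn_cat K p q : (K <= size q)%N -> lastn K (p ++ q) = lastn K q.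
Proof.
by move=> Kq; rewrite /lastn size_cat drop_cat ltnNge -addnBA // leq_addr addKn.
Qed.

Lemma lastn_id K h : (size h <= K)%N -> lastn K h = h.
Proof. by move=> hK; rewrite /lastn (eqP hK) drop0. Qed.

Lemma lastn_size K p q : size q = K -> lastn K (p ++ q) = q.
Proof. by move=> <-; rewrite lastn_cat // lastn_id. Qed.

Lemma lastn_lastn_cat K h w : lastn K (lastn K h ++ w) = lastn K (h ++ w).
Proof.
have [hK|hK] := leqP (size h) K; first by rewrite [lastn K h]lastn_id.
rewrite [in RHS](lastn_split K h) -catA [RHS]lastn_cat //.
by rewrite size_cat size_lastn (minn_idPl (ltnW hK)) leq_addr.
Qed.

Lemma lastn_min J K h : (K <= J)%N -> lastn K (lastn J h) = lastn K h.
Proof.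
move=> KJ; have [hJ|hJ] := leqP (size h) J; first by rewrite [lastn J h]lastn_id.
rewrite [in RHS](lastn_split J h) lastn_cat // size_lastn.
by rewrite (minn_idPl (ltnW hJ)).
Qed.

Lemma lastn_cat_lastn K p h : lastn K (p ++ lastn K h) = lastn K (p ++ h).
Proof.
have [hK|hK] := leqP (size h) K; first by rewrite [lastn K h]lastn_id.
rewrite !lastn_cat ?size_lastn ?(minn_idPl (ltnW hK)) ?(ltnW hK) //.
exact: lastn_min.
Qed.

End LastN.

Section Suffixes.
Variables (A : finType) (K : nat).

(* The free object of the pseudovariety of semigroups in which every product of
   K+1 factors is determined by its last K+1 letters. *)
Definition suffix_sg : Type := {x : {bseq K.+1 of A} | (0 < size x)%N}.

HB.instance Definition _ := Finite.on suffix_sg.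
HB.instance Definition _ := SubType.on suffix_sg.

Definition suffix_seq (x : suffix_sg) : seq A := val x.

Lemma suffix_seq_inj : injective suffix_seq.
Proof.
by move=> x y exy; do 2!apply: val_inj.
Qed.

Lemma to_suffix_subproof (s : seq A) : (size (lastn K.+1 s) <= K.+1)%N.
Proof. by rewrite size_lastn geq_minl. Qed.

Lemma word_suffix_subproof (w : word A) :
  (0 < size (Bseq (to_suffix_subproof w)))%N.
Proof. by rewrite /= size_lastn leq_min /= lt0n; case: w. Qed.

Definition word_suffix (w : word A) : suffix_sg :=
  exist (fun x : {bseq K.+1 of A} => is_true (0 < size x)%N)
    (Bseq (to_suffix_subproof w)) (word_suffix_subproof w).

Lemma suffix_word_subproof (x : suffix_sg) : ~~ nilp (suffix_seq x).
Proof. by case: x => x xp; rewrite /nilp -lt0n. Qed.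

Definition suffix_word (x : suffix_sg) := Word (suffix_word_subproof x).

Definition suffix_mul (x y : suffix_sg) : suffix_sg :=
  word_suffix (suffix_word x * suffix_word y).

Lemma size_suffix_seq x : (size (suffix_seq x) <= K.+1)%N.
Proof. by case: x => [[]]. Qed.

Lemma suffix_mulA : associative suffix_mul.
Proof.
move=> x y z; apply: suffix_seq_inj; rewrite /suffix_seq /=.
by rewrite lastn_cat_lastn lastn_lastn_cat catA.
Qed.

HB.instance Definition _ := isSemigroup.Build suffix_sg suffix_mulA.

Lemma word_suffixM : {morph word_suffix : u v / u * v}.
Proof.
move=> u v; apply: suffix_seq_inj; rewrite /suffix_seq /=.
by rewrite lastn_lastn_cat lastn_cat_lastn.
Qed.

(** An idempotent [e] has the full length [K.+1]: otherwise [e * e] would be strictly longer, [e]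
    being nonempty. A word of full length absorbs whatever precedes it. *)
Lemma suffix_sg_D : DD (suffix_sg : finSemigroupType).
Proof.
move=> e ee; have sz : size (suffix_seq e) = K.+1.
  apply/eqP; rewrite eqn_leq size_suffix_seq /=.
  have /(congr1 (size \o suffix_seq)) := ee.
  rewrite /suffix_seq /= size_lastn size_cat /suffix_seq.
  by have := valP e; rewrite /=; lia.
have ex x : x * e = e.
  apply: suffix_seq_inj; rewrite /suffix_seq /=; exact: lastn_size.
by apply/seteqP; split=> [_ [x _ <-]|_ ->]; [rewrite ex|exists e].
Qed.

End Suffixes.

Section Transducers.
Variable A : Type.

(* The first argument is the history: the letters already read. *)
Definition has_memory T K (c : seq A -> A -> T) :=
  forall h a, c h a = c (lastn K h) a.

Lemma has_memoryW T J K (c : seq A -> A -> T) :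
  (J <= K)%N -> has_memory J c -> has_memory K c.
Proof. by move=> JK cJ h a; rewrite cJ [RHS]cJ lastn_min. Qed.

Section Run.
Variables (B : Type) (tau : seq A -> A -> seq B).

Fixpoint run h w := if w is a :: w' then tau h a ++ run (rcons h a) w' else [::].

Lemma run_cat h w z : run h (w ++ z) = run h w ++ run (h ++ w) z.
Proof.
elim: w h => [|a w IHw] h /=; first by rewrite cats0.
by rewrite IHw catA cat_rcons.
Qed.

Lemma run_mem K h w : has_memory K tau -> run h w = run (lastn K h) w.
Proof.
move=> tauK; elim: w h => //= a w IHw h.
by rewrite tauK IHw [in RHS]IHw -!cats1 lastn_lastn_cat.
Qed.

Lemma run_suffix K p q w :
  has_memory K tau -> (K <= size q)%N -> run (p ++ q) w = run q w.
Proof. by move=> tauK Kq; rewrite (run_mem _ _ tauK) lastn_cat // -run_mem. Qed.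

End Run.

Section RunSemigroup.
Variables (S : semigroupType) (c : seq A -> A -> adj1 S).

Fixpoint prodrun h w : adj1 S :=
  if w is a :: w' then c h a * prodrun (rcons h a) w' else None.

Lemma prodrun_cat h w z : prodrun h (w ++ z) = prodrun h w * prodrun (h ++ w) z.
Proof.
elim: w h => [|a w IHw] h /=; first by rewrite cats0.
by rewrite IHw mulgA cat_rcons.
Qed.

Lemma prodrun_mem K h w : has_memory K c -> prodrun h w = prodrun (lastn K h) w.
Proof.
move=> cK; elim: w h => //= a w IHw h.
by rewrite cK IHw [in RHS]IHw -!cats1 lastn_lastn_cat.
Qed.

End RunSemigroup.
End Transducers.

Section Recognition.
Variable V : semigroup_class.
Hypotheses (pvV : pseudovariety V) (monV : monoidal V) (LSlV : subclass LSl V).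
Hypothesis VD : forall S, V S <-> pv_semidirect V DD S.
Variables (A : finType) (K : nat) (S : finSemigroupType).
Variable c : seq A -> A -> adj1 S.
Hypotheses (VS : V S) (cK : has_memory K.+1 c).

Let states := {bseq K.+1 of A}.
Let S_states : finSemigroupType := {ffun states -> adj1 S}.
Let state h : states := Bseq (@to_suffix_subproof A K h).

(** Elements of [S_states] are functions of the history; [t] acts by appending its letters to the
    history. *)
Definition shift_act (t : suffix_sg A K) (f : S_states) : S_states :=
  [ffun q : states => f (state (q ++ suffix_seq t))].

Fact shift_actM t : {morph shift_act t : f g / f * g}.
Proof. by move=> f g; apply/ffunP => q; rewrite !ffunE. Qed.

Fact shift_act_act t u f : shift_act (t * u) f = shift_act t (shift_act u f).
Proof.
apply/ffunP => q; rewrite !ffunE; congr (f _); apply: val_inj.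
by rewrite /= lastn_cat_lastn lastn_lastn_cat catA.
Qed.

Definition suffix_action := LeftAction shift_actM shift_act_act.

(** The first component records the output product from every truncated history, the second the
    letters that the next factor sees as history. *)
Definition prodrun_hom (w : word A) : sdprod suffix_action :=
  ([ffun q : states => prodrun c q w], word_suffix K w).

Lemma prodrun_homM : {morph prodrun_hom : u v / u * v}.
Proof.
move=> u v; congr pair; last exact: word_suffixM.
apply/ffunP => q; rewrite !ffunE prodrun_cat; congr (_ * _).
by rewrite (prodrun_mem _ _ cK) /= lastn_cat_lastn.
Qed.

(* This is where V = V * D enters. *)
Lemma recognition : exists r : vcong V A, forall u v, r u v ->
  lastn K.+1 u = lastn K.+1 v /\ forall h, prodrun c h u = prodrun c h v.
Proof.
have VP : V (sdprod suffix_action : finSemigroupType).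
  apply/VD => W _; apply; split; last exact: suffix_sg_D.
  exact: (pv_ffun pvV _ (pv_adj1 pvV LSlV monV VS)).
have [r rE] := vcong_of_hom pvV prodrun_homM VP.
exists r => u v; rewrite rE => /eqP[/ffunP e1 e2]; split.
  by rewrite e2.
move=> h; rewrite (prodrun_mem _ _ cK) [RHS](prodrun_mem _ _ cK).
by have := e1 (state h); rewrite !ffunE.
Qed.

End Recognition.

(** * Free pro-V semigroups *)

Section Topology.

Lemma ultra_finite (T : Type) (U : set_system T) (S : finType) (f : T -> S) :
  UltraFilter U -> exists s, U (f @^-1` [set s]).
Proof.
move=> UU; apply/not_existsP => nU.
have UP := @ultra_proper _ U UU.
have nUs (s : seq S) : U [set x | f x \notin s].
  elim: s => [|a s IHs]; first by apply: filterS filterT.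
  have [Ua|Ua] := in_ultra_setVsetC (f @^-1` [set a]) UU; first by case: (nU a).
  apply: filterS2 IHs Ua => x /= xs xa.
  by rewrite inE negb_or xs andbT; apply/eqP.
have [x /=] := filter_ex (nUs (enum S)).
by rewrite mem_enum.
Qed.

Lemma cvg_discrete_prod (I : Type) (T : I -> choiceType)
    (F : set_system (prod_topology (fun i => discrete_topology (T i))))
    (p : prod_topology (fun i => discrete_topology (T i))) :
  Filter F -> (forall i, F [set g | g i = p i]) -> F --> p.
Proof.
move=> FF Fp; apply/cvg_sup => i O [_ [[B oB <-] /= Bpi] BO].
by apply: filterS (Fp i) => g /= gi; apply: BO; rewrite /= gi.
Qed.

Lemma nbhs_discrete_prod (I : eqType) (T : I -> choiceType) i
    (p : prod_topology (fun i => discrete_topology (T i))) :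
  nbhs p [set g | g i = p i].
Proof.
have h : nbhs (proj i p : discrete_topology (T i)) [set p i].
  exact: discrete_set1.
exact: (@proj_continuous I (fun i => discrete_topology (T i)) i p _ h).
Qed.

End Topology.

Section Approximation.
Variable V : semigroup_class.
Hypothesis pvV : pseudovariety V.
Variable A : choiceType.
Implicit Types (r s : vcong V A) (u v : freepro V A) (w z : word A).

Definition approx r u w := freepro_proj r u = \pi_(quo r) w.

Lemma approx_ex r u : exists w, approx r u w.
Proof. by exists (repr (freepro_proj r u)); rewrite /approx reprK. Qed.

Lemma approx_sub r s u w : subrel r s -> approx r u w -> approx s u w.
Proof.
move=> rs; rewrite /approx /freepro_proj => uw.
rewrite -(set_mem (valP u) r s rs) uw.
by apply/quo_piP/rs; exact: repr_pi.
Qed.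

Lemma approx_word r w : approx r (freepro_word V w) w.
Proof. by []. Qed.

Lemma approxM r u v w z : approx r u w -> approx r v z -> approx r (u * v) (w * z).
Proof. by rewrite /approx quo_piM => <- <-. Qed.

Lemma approx_cong r u w z : approx r u w -> approx r u z -> r w z.
Proof. by rewrite /approx => -> /quo_piP. Qed.

Lemma freepro_eq u v :
  (forall r, exists w, approx r u w /\ approx r v w) -> u = v.
Proof.
move=> uv; apply: val_inj; apply: functional_extensionality_dep => r.
by have [w [uw vw]] := uv r; rewrite -[LHS]/(freepro_proj r u) uw -vw.
Qed.

Definition cone u r : set (freepro V A) :=
  [set v | freepro_proj r v = freepro_proj r u].

Lemma cvg_freepro (F : set_system (freepro V A)) u :
  Filter F -> (forall r, F (cone u r)) -> F --> u.
Proof.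
move=> FF Fu P [_ [[O oO <-] /= Ou] OP].
have cF : (val @ F : set_system (quo_product V A)) --> (val u : quo_product V A).
  by apply: cvg_discrete_prod => r; exact: (Fu r).
have /cF FO : nbhs (val u : quo_product V A) O by apply: open_nbhs_nbhs.
exact: filterS OP FO.
Qed.

Lemma cone_filter u : ProperFilter (filter_from [set: vcong V A] (cone u)).
Proof.
apply: filter_from_proper; last by move=> r _; exists u.
apply: filter_from_filter; first by have [r _] := vcong_top pvV A; exists r.
move=> r s _ _; have [t [tr ts]] := vcong_meet pvV r s; exists t => //.
move=> v /= vu; have [w uw] := approx_ex t u.
have vw : approx t v w by rewrite /approx vu.
split; rewrite /cone /=.
  by rewrite (approx_sub tr uw) (approx_sub tr vw).
by rewrite (approx_sub ts uw) (approx_sub ts vw).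
Qed.

(** The cones at [u] generate a filter because congruences have common refinements, and this filter
    converges to [u]. Conversely a cone is the preimage of a point under a continuous projection to
    a discrete space. *)
Lemma nbhs_freepro u (P : set (freepro V A)) :
  nbhs u P <-> exists r, cone u r `<=` P.
Proof.
split.
  have cu := cone_filter u.
  have /[apply] : filter_from [set: vcong V A] (cone u) --> u.
    by apply: cvg_freepro => r; exists r.
  by case=> r _ rP; exists r.
case=> r rP; apply: filterS rP _.
have vc : continuous (val : freepro V A -> quo_product V A).
  exact: initial_continuous.
exact: vc (nbhs_discrete_prod r (val u)).
Qed.

Lemma freepro_compact : compact [set: freepro V A].
Proof.
rewrite compact_ultra => F UF _; have PF := @ultra_proper _ F UF.
have Fc r : exists c, F [set u | freepro_proj r u = c].
  have [S [f [_ _ rE]]] := vcongP r.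
  have [s Us] := ultra_finite (fun u => f (repr (freepro_proj r u))) UF.
  have [u us] := filter_ex Us; exists (freepro_proj r u).
  apply: filterS Us => v /= vs.
  rewrite -[LHS]reprK -[RHS]reprK; apply/quo_piP.
  by rewrite rE vs -us.
pose c r := sval (cid (Fc r)); have cF r := svalP (cid (Fc r)).
have cl : quo_limit (c : quo_product V A).
  move=> r s rs; have [u [/= ur us]] := filter_ex (filterI (cF r) (cF s)).
  by rewrite /c -ur -us; exact: (set_mem (valP u)).
exists (exist (fun y => y \in @quo_limit V A) _ (mem_set cl)); split=> //.
by apply: cvg_freepro => r; exact: (cF r).
Qed.

Lemma freepro_hausdorff : hausdorff_space (freepro V A).
Proof.
move=> u v uv; apply: freepro_eq => r.
have nb x : nbhs x (cone x r) by apply/nbhs_freepro; exists r.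
have [x [/= xu xv]] := uv _ _ (nb u) (nb v).
by have [w xw] := approx_ex r x; exists w; rewrite /approx -xu -xv.
Qed.

Lemma closure_freepro (E : set (freepro V A)) u :
  closure E u <-> forall r, exists v, E v /\ freepro_proj r v = freepro_proj r u.
Proof.
split=> [clE r|H P /nbhs_freepro[r rP]].
  by have [|v [Ev uv]] := clE (cone u r); [apply/nbhs_freepro; exists r|exists v].
by have [v [Ev vu]] := H r; exists v; split=> //; apply: rP.
Qed.

Lemma closure_words (E : set (word A)) u :
  closure (@freepro_word V A @` E) u <-> forall r, exists w, E w /\ approx r u w.
Proof.
split=> [/closure_freepro H r|H].
  by have [_ [[w Ew <-] wu]] := H r; exists w; split=> //; rewrite /approx -wu.
apply/closure_freepro => r; have [w [Ew uw]] := H r.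
by exists (freepro_word V w); split; [exists w|rewrite uw].
Qed.

(** The image of a compact space is closed, so an equation [u = f t] that is solvable in every
    finite quotient is solvable. *)
Lemma compact_preimage (T : topologicalType) (f : T -> freepro V A) u :
  compact [set: T] -> continuous f ->
  (forall r, exists t, freepro_proj r (f t) = freepro_proj r u) ->
  exists t, u = f t.
Proof.
move=> cT cf H; have cfT : compact (f @` [set: T]).
  by apply: continuous_compact => //; exact: continuous_subspaceT.
have /closure_id clF := compact_closed freepro_hausdorff cfT.
have : closure (f @` [set: T]) u.
  apply/closure_freepro => r; have [t ft] := H r.
  by exists (f t); split=> //; exists t.
by rewrite -clF => -[t _ <-]; exists t.
Qed.

Lemma mulr_continuous x : continuous (fun u : freepro V A => u * x).
Proof.
move=> u P /nbhs_freepro[r rP]; apply/nbhs_freepro; exists r => v vu.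
by apply: rP; rewrite /cone /= -[LHS]/(freepro_proj r v * freepro_proj r x) vu.
Qed.

Lemma mull_continuous x : continuous (fun u : freepro V A => x * u).
Proof.
move=> u P /nbhs_freepro[r rP]; apply/nbhs_freepro; exists r => v vu.
by apply: rP; rewrite /cone /= -[LHS]/(freepro_proj r x * freepro_proj r v) vu.
Qed.

Lemma mullr_continuous x y : continuous (fun u : freepro V A => x * u * y).
Proof.
move=> u; apply: (@continuous_comp _ _ _ (fun u => x * u) (fun u => u * y)).
  exact: mull_continuous.
exact: mulr_continuous.
Qed.

(** A factorisation of representatives that occurs at every precision survives in the limit, with a
    pseudoword as cofactor. *)
Lemma split_right u x :
  (forall r, exists w, exists2 y, approx r x y & approx r u (w * y)) ->
  exists p, u = p * x.
Proof.
move=> H.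
have [r|p ->] := compact_preimage (u := u) freepro_compact (@mulr_continuous x);
  last by exists p.
have [w [y xy uwy]] := H r; exists (freepro_word V w).
by rewrite uwy; exact: approxM.
Qed.

Lemma split_left u x :
  (forall r, exists w, exists2 y, approx r x y & approx r u (y * w)) ->
  exists p, u = x * p.
Proof.
move=> H.
have [r|p ->] := compact_preimage (u := u) freepro_compact (@mull_continuous x);
  last by exists p.
have [w [y xy uwy]] := H r; exists (freepro_word V w).
by rewrite uwy; exact: approxM.
Qed.

Lemma split_middle u x :
  (forall r, exists w z, exists2 y, approx r x y & approx r u (w * y * z)) ->
  exists p q, u = p * x * q.
Proof.
move=> H; pose F (p : freepro V A * freepro V A) := p.1 * x * p.2.
have [||r|[p q] ->] := @compact_preimage _ F u; last by exists p, q.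
- by rewrite -setXTT; apply: compact_setX; exact: freepro_compact.
- move=> p P /nbhs_freepro[r rP].
  exists (cone p.1 r, cone p.2 r); first by split; apply/nbhs_freepro; exists r.
  move=> [a b] [/= ap bp]; apply: rP; rewrite /cone /= /F.
  rewrite -[LHS]/(freepro_proj r a * freepro_proj r x * freepro_proj r b).
  by rewrite ap bp.
- have [w [z [y xy uwz]]] := H r.
  exists (freepro_word V w, freepro_word V z).
  by rewrite uwz; apply: approxM => //; exact: approxM.
Qed.

End Approximation.

Section Near.
Variable V : semigroup_class.
Hypothesis pvV : pseudovariety V.
Variable A : choiceType.
Implicit Types (r s : vcong V A) (u v : freepro V A) (w z : word A).
Implicit Types P Q : word A -> Prop.

Definition near_words u P := exists r, forall w, approx r u w -> P w.

Definition recognizable P := exists r, forall w z, r w z -> P w -> P z.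

Lemma near_ex u P r : near_words u P -> exists2 w, approx r u w & P w.
Proof.
case=> s sP; have [t [tr ts]] := vcong_meet pvV r s.
have [w uw] := approx_ex t u; exists w; first exact: approx_sub uw.
exact/sP/(approx_sub ts).
Qed.

Lemma near_and u P Q :
  near_words u P -> near_words u Q -> near_words u (fun w => P w /\ Q w).
Proof.
move=> [r rP] [s sQ]; have [t [tr ts]] := vcong_meet pvV r s; exists t => w uw.
by split; [exact/rP/(approx_sub tr)|exact/sQ/(approx_sub ts)].
Qed.

Lemma near_sub u P Q : (forall w, P w -> Q w) -> near_words u P -> near_words u Q.
Proof. by move=> PQ [r rP]; exists r => w /rP /PQ. Qed.

(** A recognizable property is constant on classes, so one representative at the recognising
    precision decides it for all of them. *)
Lemma near_rec u P :
  recognizable P -> (forall r, exists2 w, approx r u w & P w) -> near_words u P.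
Proof.
move=> [r rP] H; have [w uw Pw] := H r.
by exists r => z uz; apply: rP Pw; exact: approx_cong uw uz.
Qed.

Lemma near_mul u v P Q R : recognizable R -> near_words u P -> near_words v Q ->
  (forall w z, P w -> Q z -> R (w * z)) -> near_words (u * v) R.
Proof.
move=> recR uP vQ PQR; apply: near_rec recR _ => r.
have [w uw Pw] := near_ex r uP; have [z vz Qz] := near_ex r vQ.
by exists (w * z); [exact: approxM|exact: PQR].
Qed.

End Near.

Section Extension.
Variable V : semigroup_class.
Hypothesis pvV : pseudovariety V.
Variables A B : choiceType.

Definition uniform (F : word A -> word B) := forall s : vcong V B,
  exists r : vcong V A, forall w z, r w z -> s (F w) (F z).

Definition extends (F : word A -> word B) (Fh : freepro V A -> freepro V B) :=
  forall s, exists r, forall u w, approx r u w -> approx s (Fh u) (F w).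

(** At each precision [s] the value is the image of a representative at precision [m s]. Two
    precisions are compared through a common representative at their meet. *)
Lemma ext_exists F : uniform F -> exists Fh, extends F Fh.
Proof.
move=> unifF; have [m mF] := choice unifF.
pose Fr (u : freepro V A) s := \pi_(quo s) (F (repr (freepro_proj (m s) u))).
have Fw u s (r : vcong V A) w : subrel r (m s) -> approx r u w -> Fr u s = \pi_(quo s) (F w).
  move=> rms uw; apply/quo_piP/mF; rewrite (approx_sub rms uw).
  exact: repr_pi.
have FL u : quo_limit (Fr u : quo_product V B).
  move=> s s' ss'; have [t [ts ts']] := vcong_meet pvV (m s) (m s').
  have [w uw] := approx_ex t u; rewrite (Fw _ _ _ _ ts uw) (Fw _ _ _ _ ts' uw).
  by apply/quo_piP/ss'; exact: repr_pi.
exists (fun u => exist (fun y => y \in @quo_limit V B) _ (mem_set (FL u))).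
by move=> s; exists (m s) => u w uw; exact: Fw uw.
Qed.

Lemma extends_continuous F Fh : extends F Fh -> continuous Fh.
Proof.
move=> FFh u P /(nbhs_freepro pvV)[s sP].
have [r rF] := FFh s; apply/(nbhs_freepro pvV); exists r => v vu; apply: sP.
have [w uw] := approx_ex r u.
have vw : approx r v w by rewrite /approx vu.
by rewrite /cone /= (rF _ _ uw) (rF _ _ vw).
Qed.

End Extension.

Lemma suffix_lastn (A : eqType) (x h : seq A) : suffix x h = (lastn (size x) h == x).
Proof. by rewrite suffixE. Qed.

Section RecognizableLanguages.
Variable V : semigroup_class.
Hypotheses (pvV : pseudovariety V) (monV : monoidal V) (LSlV : subclass LSl V).
Hypothesis VD : forall S, V S <-> pv_semidirect V DD S.
Variable A : finType.

Lemma pv_unit_sg : V (unit : finSemigroupType).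
Proof. by apply: (pv_unit pvV); rewrite card_unit. Qed.

Lemma rec_lastn K : exists r : vcong V A, forall u v, r u v -> lastn K u = lastn K v.
Proof.
have cK : has_memory K.+1 (fun (_ : seq A) (_ : A) => None : adj1 unit) by [].
have [r rP] := recognition pvV monV LSlV VD pv_unit_sg cK.
exists r => u v /rP[e _].
by rewrite -[LHS](lastn_min _ (leqnSn K)) e lastn_min.
Qed.

(** The value [Some tt] marks an occurrence of [x] ending at the letter just read, and it persists
    in the product. *)
Lemma prodrun_infix (x h w : seq A) :
  let c h a := if suffix x (rcons h a) then Some tt else None : adj1 unit in
  prodrun c h w <> None <->
  exists w1 w2, [/\ w = w1 ++ w2, w1 <> [::] & suffix x (h ++ w1)].
Proof.
move=> c; elim: w h => [|a w IHw] h /=.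
  by split=> // -[[|a w1] [w2 []]].
rewrite {1}/c; case: ifP => sx.
  split=> [_|_]; last by case: (prodrun _ _ _).
  by exists [:: a], w; rewrite cats1.
rewrite adj_1mul IHw; split=> -[w1 [w2 [e n sx']]].
  by exists (a :: w1), w2; rewrite e -cat_rcons.
case: w1 e n sx' => // b w1 [<- e] _; rewrite -cat_rcons => sx'.
by case: w1 e sx' => [|b' w1] e sx'; [rewrite cats0 sx in sx'|exists (b' :: w1), w2].
Qed.

Lemma rec_infix n : exists r : vcong V A, forall u v, r u v ->
  forall x, (size x <= n)%N -> infix x u = infix x v.
Proof.
suff H (x : {bseq n of A}) : exists r : vcong V A, forall u v : word A, r u v ->
    infix x u = infix x v.
  have [|t tP] := vcong_meets pvV (enum {bseq n of A}) H.
    by move=> x r t tr xr u v /tr; exact: xr.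
  exists t => u v tuv x xn.
  by have := tP (Bseq xn); rewrite mem_enum; apply.
case: x => x xn /=.
(* Occurrences are reported only after reading a letter, so the empty factor is treated apart. *)
have [->|x0] := eqVneq x [::].
  by have [r _] := vcong_top pvV A; exists r => u v _; rewrite !infix0s.
pose c h a := if suffix x (rcons h a) then Some tt else None : adj1 unit.
have cK : has_memory n.+1 c.
  move=> h a; rewrite /c; congr (if _ then _ else _); rewrite !suffix_lastn -!cats1.
  rewrite -[in LHS](@lastn_min _ n.+1) ?(leqW xn) // -(lastn_lastn_cat _ h).
  by rewrite lastn_min // leqW.
have [r rP] := recognition pvV monV LSlV VD pv_unit_sg cK.
have inf (u : word A) : infix x u <-> prodrun c [::] u <> None.
  rewrite (prodrun_infix x [::] u); split=> [/infixP[p [s e]]|].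
    exists (p ++ x), s; rewrite suffix_suffix e catA; split=> //.
    by case: (p) (x) x0 => [|? ?] [].
  case=> w1 [w2 [-> _ /suffixP[p /= ->]]].
  by apply/infixP; exists p, w2; rewrite catA.
exists r => u v /rP[_ /(_ [::]) e].
by apply/idP/idP => /inf c0; apply/inf; [rewrite -e|rewrite e].
Qed.

End RecognizableLanguages.

Section Transduction.
Variable V : semigroup_class.
Hypotheses (pvV : pseudovariety V) (monV : monoidal V) (LSlV : subclass LSl V).
Hypothesis VD : forall S, V S <-> pv_semidirect V DD S.
Variables (A B : finType) (K : nat) (tau : seq A -> A -> seq B) (b0 : B).
Hypothesis tauK : has_memory K tau.

(* The junk value [letter b0] makes the output total; it is only ever used on
   words with a nonempty output. *)
Definition runw h (w : seq A) : word B := insubd (letter b0) (run tau h w).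

Lemma runwE h w : run tau h w <> [::] -> wseq (runw h w) = run tau h w.
Proof. by move=> /eqP n0; rewrite -[LHS]/(val _) val_insubd /nilp size_eq0 n0. Qed.

(** The output is evaluated in [S] with an identity adjoined, the empty output giving [None]; hence
    its emptiness and its class are recognised together. *)
Lemma rec_run (s : vcong V B) : exists r : vcong V A, forall w z : word A, r w z ->
  forall h, (run tau h w == [::]) = (run tau h z == [::]) /\
            s (runw h w) (runw h z).
Proof.
have [S [f [VS _ sE]]] := vcongP s.
pose psi (x : seq B) : adj1 S := omap f (insub x : option (word B)).
have psi_cat x y : psi (x ++ y) = psi x * psi y.
  rewrite /psi; case: (insubP _ x) => [u u0 ux|/negPn/nilP ->]; last first.
    by rewrite cat0s.
  case: (insubP _ y) => [v v0 vy|/negPn/nilP ->]; last first.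
    by rewrite cats0 -ux valK.
  by rewrite -ux -vy -[_ ++ _]/(val (u * v)) valK /= gmulfM.
have psiE h w : prodrun (fun h a => psi (tau h a)) h w = psi (run tau h w).
  elim: w h => [|a w IHw] h /=; last by rewrite psi_cat IHw.
  by rewrite /psi insubF.
have cK : has_memory K.+1 (fun h a => psi (tau h a)).
  by move=> h a; rewrite (has_memoryW (leqnSn K) tauK).
have [r rP] := recognition pvV monV LSlV VD VS cK.
exists r => w z /rP[_ e] h; have := e h; rewrite !psiE /psi /runw /insubd.
case: (insubP _ (run tau h w)) => [u u0 ux|/negPn/nilP ->];
  case: (insubP _ (run tau h z)) => [v v0 vx|/negPn/nilP ->] //=.
  rewrite -ux -vx => -[fe]; rewrite sE fe eqxx; split=> //.
  by move: u0 v0; rewrite -ux -vx /nilp !size_eq0 => /negPf -> /negPf ->.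
by rewrite sE eqxx.
Qed.

Lemma runw_uniform h : uniform V (fun w : word A => runw h w).
Proof. by move=> s; have [r rP] := rec_run s; exists r => w z /rP/(_ h)[]. Qed.

Lemma rec_run_neq0 h : recognizable V (fun w : word A => run tau h w <> [::]).
Proof.
have [s _] := vcong_top pvV B; have [r rP] := rec_run s.
by exists r => w z /rP/(_ h)[e _] /eqP; rewrite e => /eqP.
Qed.

Lemma rec_runs_neq0 :
  recognizable V (fun w : word A => forall h, run tau h w <> [::]).
Proof.
have [s _] := vcong_top pvV B; have [r rP] := rec_run s.
by exists r => w z /rP rwz nz h; have := nz h; have [e _] := rwz h => /eqP; rewrite e => /eqP.
Qed.

End Transduction.

(** * Languages and transductions between them *)

Lemma infix_overlap (A : eqType) (x s1 s2 s3 : seq A) :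
  (size x <= size s2)%N -> infix x (s1 ++ s2 ++ s3) ->
  infix x (s1 ++ s2) \/ infix x (s2 ++ s3).
Proof.
move=> xs2 /infixP[p [q e]].
have [le|lt] := leqP (size p + size x) (size s1 + size s2); [left|right].
  have := congr1 (take (size s1 + size s2)) e.
  rewrite catA take_size_cat ?size_cat // catA take_cat size_cat ltnNge.
  case: ltngtP le => // [_ _|-> _].
    by move=> ->; rewrite -catA infix_infix.
  by rewrite subnn take0 cats0 => ->; exact: suffix_infix.
have := congr1 (drop (size s1)) e.
rewrite drop_size_cat // drop_cat; case: ltnP => [_|]; last by lia.
by move=> ->; exact: infix_infix.
Qed.

Lemma word_of_seq (A : choiceType) (s : seq A) :
  s <> [::] -> exists w : word A, wseq w = s.
Proof. by move=> /eqP; rewrite -size_eq0 => s0; exists (Word s0). Qed.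

Record prolongable (A : eqType) (L : seq A -> Prop) : Prop := {
  pl_infix : forall x w, infix x w -> L w -> L x;
  pl_left : forall w, L w -> exists a, L (a :: w);
  pl_right : forall w, L w -> exists a, L (rcons w a)
}.

Section LocalLanguage.
Variables (A : eqType) (L : seq A -> Prop).
Hypothesis plL : prolongable L.

(** Local approximation of [L]. Membership depends on finitely many factors, hence on a congruence
    of [V], whereas [L] itself need not be recognizable. *)
Definition loc n (w : seq A) := forall x, infix x w -> (size x <= n)%N -> L x.

Lemma loc_infix n x w : infix x w -> loc n w -> loc n x.
Proof. by move=> xw Lw y yx; apply: Lw; exact: infix_trans yx xw. Qed.

Lemma locW n m w : (m <= n)%N -> loc n w -> loc m w.
Proof. by move=> mn Lw x xw xm; apply: Lw xw _; exact: leq_trans mn. Qed.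

Lemma loc_lang n w : L w -> loc n w.
Proof. by move=> Lw x xw _; exact: (pl_infix plL) Lw. Qed.

Lemma lang_loc n w : (size w <= n)%N -> loc n w -> L w.
Proof. by move=> wn; apply => //; exact: infix_refl. Qed.

(** It suffices to prolong the first or last [n] letters inside [L]: a factor of length at most [n]
    that uses the new letter stays within them. *)
Lemma loc_prolongable n : prolongable (loc n).
Proof.
split; first exact: loc_infix.
- move=> w Lw; have [|a La] := @pl_left _ _ plL (take n w).
    by apply: Lw; [exact: infix_take|rewrite size_take_min geq_minl].
  exists a => x; rewrite infix_consl => /orP[|]; last exact: Lw.
  case: x => [|b x] xw xn; first by apply: (pl_infix plL) La; rewrite infix0s.
  move: xw; rewrite prefix_cons => /andP[/eqP -> /prefixP[z wE]].
  apply: (pl_infix plL) La; apply: prefixW; rewrite prefix_cons eqxx /=.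
  by rewrite wE prefixE take_takel ?take_size_cat //; apply: ltnW.
- move=> w Lw; have [|a La] := @pl_right _ _ plL (lastn n w).
    by apply: Lw; [exact: infix_drop|rewrite size_lastn geq_minl].
  exists a => x; rewrite infix_rconsl => /orP[|]; last exact: Lw.
  rewrite suffix_lastn => /eqP <-; rewrite size_lastn => xn.
  apply: (pl_infix plL) La; have [xn'|nx] := leqP (size x) n.
    rewrite -(@lastn_min _ n) // -!cats1 -lastn_lastn_cat lastn_min //.
    exact: infix_drop.
  have [wn|nw] := leqP (size w) n; first by rewrite [lastn n w]lastn_id ?infix_drop.
  by move: xn; rewrite size_rcons; lia.
Qed.

End LocalLanguage.

(** The value [true] of [b] leads to the closure of [L], hence to the shadow; [false] leads to
    limits of words that are locally in [L] to ever higher order, which form the mirage. *)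
Definition language_family (A : eqType) (b : bool) (L : seq A -> Prop) n :=
  if b then L else loc L n.

Section LanguageFamily.
Variables (A : eqType) (b : bool) (L : seq A -> Prop).
Hypothesis plL : prolongable L.

Lemma family_prolongable n : prolongable (language_family b L n).
Proof. by case: b => //; exact: loc_prolongable. Qed.

Lemma family_loc n w : language_family b L n w -> loc L n w.
Proof. by case: b => //; exact: loc_lang. Qed.

Lemma familyW n m w : (m <= n)%N ->
  language_family b L n w -> language_family b L m w.
Proof. by case: b => // mn; exact: locW. Qed.

End LanguageFamily.

(* [tau] with memory [K] carries words of [LX] to words of [LY], once the
   history contains K letters; at most [g - 1] consecutive outputs are empty. *)
Record transduces (A B : eqType) (LX : seq A -> Prop) (LY : seq B -> Prop) K g
    (tau : seq A -> A -> seq B) : Prop := {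
  td_mem : has_memory K tau;
  td_lang : forall p w, (K <= size p)%N -> LX (p ++ w) -> LY (run tau p w);
  td_gap : forall p w, (K <= size p)%N -> (g <= size w)%N -> LX (p ++ w) ->
    run tau p w <> [::]
}.

Section Transduces.
Variables (A B : eqType) (LX : seq A -> Prop) (LY : seq B -> Prop) (K g : nat).
Variable tau : seq A -> A -> seq B.
Hypothesis plY : prolongable LY.
Hypothesis tauP : transduces LX LY K g tau.

(** Each block of [g] letters outputs at least one letter. With the history cut to [K] letters, only
    factors of length at most [K + g] have to lie in [LX]. *)
Lemma run_loc_size N n p w : (K + g <= N)%N -> (K <= size p)%N ->
  (n * g <= size w)%N -> loc LX N (p ++ w) -> (n <= size (run tau p w))%N.
Proof.
move=> gN; elim: n p w => // n IHn p w Kp; rewrite mulSn => nw Lpw.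
rewrite -(cat_take_drop g w) run_cat size_cat -add1n; apply: leq_add.
  rewrite lt0n size_eq0; apply/eqP; rewrite (run_mem _ _ (td_mem tauP)).
  apply: (td_gap tauP).
  - by rewrite size_lastn; lia.
  - by rewrite size_take_min; lia.
  - apply: Lpw; last by rewrite size_cat size_lastn size_take_min; lia.
    apply/infixP; exists (take (size p - K) p), (drop g w).
    by rewrite !catA -lastn_split -catA cat_take_drop.
apply: IHn; rewrite ?size_cat ?size_drop; try by lia.
by rewrite -catA cat_take_drop.
Qed.

Lemma run_loc_neq0 N p w : (K + g <= N)%N -> (K <= size p)%N ->
  (g <= size w)%N -> loc LX N (p ++ w) -> run tau p w <> [::].
Proof.
move=> gN Kp gw Lpw; have := run_loc_size (n := 1) gN Kp _ Lpw.
by rewrite mul1n => /(_ gw); case: (run _ _ _).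
Qed.

(** Induction on the length of [w]. A short [w], with its history cut to [K] letters, lies in [LX].
    For a long [w] the inner letters output more than [n] letters, so a factor of length at most [n]
    misses the output of the first or of the last letter. *)
Lemma run_loc n : exists N, forall p w, (K <= size p)%N -> loc LX N (p ++ w) ->
  loc LY n (run tau p w).
Proof.
pose N := (K + g + (n.+1 * g).+2)%N; exists N => p w.
have [m] := ubnP (size w); elim: m p w => // m IHm p w wm Kp Lpw x xw xn.
have [wN|Nw] := leqP (size w) (n.+1 * g).+1.
  apply: (pl_infix plY xw); rewrite (run_mem _ _ (td_mem tauP)).
  apply: (td_lang tauP); first by rewrite size_lastn; lia.
  apply: Lpw; last by rewrite size_cat size_lastn; lia.
  by apply/infixP; exists (take (size p - K) p), [::]; rewrite cats0 catA -lastn_split.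
case: w wm Lpw xw Nw => [|a w] //; case/lastP: w => [|w c] //.
rewrite /= size_rcons -(cats1 w) run_cat => wm Lpw xw Nw.
have Lpaw : loc LX N (rcons p a ++ w).
  by apply: loc_infix Lpw; rewrite cat_rcons -cat_cons catA prefix_infix.
have big : (n.+1 <= size (run tau (rcons p a) w))%N.
  by apply: run_loc_size Lpaw; rewrite ?size_rcons; lia.
have xbig := leq_trans xn (ltnW big).
have [xw'|xw'] := infix_overlap xbig xw.
  apply: (IHm p (a :: w)) xw' xn => //=.
  by rewrite -cat_rcons.
move: xw'; rewrite -run_cat => xw'.
apply: (IHm (rcons p a) (w ++ [:: c])) xw' xn.
- by rewrite size_cat addn1; lia.
- by rewrite size_rcons; lia.
- by rewrite cat_rcons.
Qed.

End Transduces.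

Lemma run_family (A B : eqType) (LX : seq A -> Prop) (LY : seq B -> Prop) K g tau b n :
  prolongable LY -> transduces LX LY K g tau ->
  exists N, forall p w, (K <= size p)%N ->
  language_family b LX N (p ++ w) -> language_family b LY n (run tau p w).
Proof.
move=> plY tauP; case: b; last exact: (run_loc plY tauP).
by exists 0%N => p w; apply: (td_lang tauP).
Qed.

(* The composite of [tau] and [gam] reproduces its input with a delay: [rho q]
   is the suffix of the history [q] that has not been output yet. *)
Record delays (A B : eqType) (LX : seq A -> Prop) K (tau : seq A -> A -> seq B)
    (gam : seq B -> B -> seq A) (rho : seq A -> seq A) : Prop := {
  dl_mem : forall q, rho q = rho (lastn K q);
  dl_suffix : forall q, suffix (rho q) q;
  dl_run : forall q z a, (K <= size q)%N -> (K <= size (run tau q z))%N ->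
    LX (q ++ rcons z a) ->
    run gam (run tau q z) (tau (q ++ z) a) ++ rho (q ++ rcons z a) =
    rcons (rho (q ++ z)) a
}.

Section Delays.
Variables (A B : eqType) (LX : seq A -> Prop) (LY : seq B -> Prop) (K g : nat).
Variables (tau : seq A -> A -> seq B) (gam : seq B -> B -> seq A).
Variable rho : seq A -> seq A.
Hypotheses (tauP : transduces LX LY K g tau).
Hypotheses (gamK : has_memory K gam) (tgP : delays LX K tau gam rho).

Lemma rho_cat p q : (K <= size q)%N -> rho (p ++ q) = rho q.
Proof. by move=> Kq; rewrite (dl_mem tgP) lastn_cat // -(dl_mem tgP). Qed.

(** [dl_run] asks for a word of [LX], and only a local condition is at hand. The last [K * g]
    letters of [z] suffice: they output at least [K] letters, all that [gam] remembers, and [K]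
    letters of history before them fix [tau] and [rho]. *)
Lemma run_delay1 q z a : (K <= size q)%N -> (K * g <= size z)%N ->
  loc LX (K + K * g + g).+1 (q ++ rcons z a) ->
  run gam (run tau q z) (tau (q ++ z) a) ++ rho (q ++ rcons z a) =
  rcons (rho (q ++ z)) a.
Proof.
move=> Kq Kz; rewrite {1 2 3 4 5}(lastn_split (K * g) z).
set z1 := take _ z; set z2 := lastn _ z => Lqza.
have sz2 : size z2 = (K * g)%N by rewrite size_lastn; lia.
pose q' := lastn K (q ++ z1).
have sq' : size q' = K by rewrite size_lastn size_cat; lia.
have Lqz : infix (q' ++ rcons z2 a) (q ++ rcons (z1 ++ z2) a).
  apply/infixP; exists (take (size (q ++ z1) - K) (q ++ z1)), [::].
  by rewrite cats0 catA /q' -lastn_split -!cats1 !catA.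
have e1 : tau (q ++ z1 ++ z2) a = tau (q' ++ z2) a.
  by rewrite (td_mem tauP) [RHS](td_mem tauP) lastn_lastn_cat catA.
have e2 s : rho (q ++ z1 ++ s) = rho (q' ++ s).
  by rewrite (dl_mem tgP) [RHS](dl_mem tgP) lastn_lastn_cat catA.
have Kr : (K <= size (run tau q' z2))%N.
  apply: (run_loc_size tauP (N := (K + K * g + g).+1)); rewrite ?sq' ?sz2 //; first lia.
  apply: loc_infix Lqza; apply: infix_trans Lqz.
  by rewrite -cats1 catA prefix_infix.
rewrite e1 run_cat (run_mem (q ++ z1) z2 (td_mem tauP)) (run_suffix _ _ gamK) //.
rewrite -!cats1 -!catA !e2 !cats1; apply: (dl_run tgP) => //; first by rewrite sq'.
by apply: Lqza => //; rewrite size_cat size_rcons sq' sz2; lia.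
Qed.

Lemma run_delay q z w : (K <= size q)%N -> (K * g <= size z)%N ->
  loc LX (K + K * g + g).+1 (q ++ z ++ w) ->
  run gam (run tau q z) (run tau (q ++ z) w) ++ rho (q ++ z ++ w) =
  rho (q ++ z) ++ w.
Proof.
move=> Kq; elim: w z => [|a w IHw] z Kz Lqzw; first by rewrite !cats0.
have Lqza : loc LX (K + K * g + g).+1 (q ++ rcons z a).
  by apply: loc_infix Lqzw; rewrite -cat_rcons catA prefix_infix.
have := IHw (rcons z a); rewrite size_rcons !cat_rcons leqW // => /(_ isT Lqzw).
have -> : run tau q (rcons z a) = run tau q z ++ tau (q ++ z) a.
  by rewrite -cats1 run_cat /= cats0.
rewrite /= run_cat -catA rcons_cat => ->.
by rewrite catA run_delay1 // cat_rcons.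
Qed.

End Delays.

(** * Maximal subgroups *)

Section Idempotents.
Variable S : semigroupType.
Implicit Types e u v x y : S.

(** For an idempotent [e], the group of units of the local monoid at [e], that is, the maximal
    subgroup containing [e]. *)
Definition unit_group e : set S :=
  [set u | [/\ e * u = u, u * e = u &
    exists v, [/\ e * v = v, v * e = v, u * v = e & v * u = e]]].

Lemma unit_group1 e : idem e -> unit_group e e.
Proof. by move=> ee; split=> //; exists e. Qed.

Lemma Jle_refl u : Jle u u.
Proof. by exists None, None. Qed.

Lemma Jle_mul x u y : Jle (x * u * y) u.
Proof. by exists (Some x), (Some y); rewrite /= mulgA. Qed.

Lemma Jle_mull x u : Jle (x * u) u.
Proof. by exists (Some x), None. Qed.

Lemma Jle_mulr u x : Jle (u * x) u.
Proof. by exists None, (Some x). Qed.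

Lemma Jle_trans v u w : Jle u v -> Jle v w -> Jle u w.
Proof.
case=> x [y ->] [x' [y' ->]].
exists (match x, x' with
        | Some a, Some b => Some (a * b) | None, _ => x' | _, None => x end).
exists (match y', y with
        | Some a, Some b => Some (a * b) | None, _ => y | _, None => y' end).
by case: x x' y y' => [x|] [x'|] [y|] [y'|]; rewrite /= ?mulgA.
Qed.

Lemma Jle_idemr e v : idem e -> Jle v e -> exists x y, v = x * e * y.
Proof.
move=> ee [x [y ->]].
exists (if x is Some x then x * e else e), (if y is Some y then e * y else e).
have ea a : e * (e * a) = e * a by rewrite mulgA ee.
by case: x y => [x|] [y|]; rewrite /= -?mulgA ?ea ?ee.
Qed.

Lemma Jle_idem e v : idem e -> Jle e v -> exists x y, e = x * v * y.
Proof.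
move=> ee [x [y exy]].
exists (if x is Some x then e * x else e), (if y is Some y then y * e else e).
rewrite -[in LHS]ee -[X in X * e]ee {2}exy.
by case: x y {exy} => [x|] [y|]; rewrite /= ?mulgA.
Qed.

Lemma unit_group_Jle e u : unit_group e u -> Jle u e /\ Jle e u.
Proof.
case=> eu _ [v [_ _ uv _]]; split; first by rewrite -eu; exact: Jle_mulr.
by rewrite -uv; exact: Jle_mulr.
Qed.

Lemma subgroup_unit_group e : idem e -> subgroup (unit_group e).
Proof.
move=> ee; split=> [x y|].
  move=> [ex xe [x' [ex' x'e xx' x'x]]] [ey ye [y' [ey' y'e yy' y'y]]].
  split; first by rewrite mulgA ex.
    by rewrite -mulgA ye.
  exists (y' * x'); split; first by rewrite mulgA ey'.
  - by rewrite -mulgA x'e.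
  - by rewrite mulgA -(mulgA x) yy' xe.
  - by rewrite mulgA -(mulgA y') x'x y'e.
exists e; split; first exact: unit_group1.
  by move=> x [].
move=> x [ex xe [y [ey ye xy yx]]]; exists y; split=> //.
by split=> //; exists x.
Qed.

Lemma maximal_subgroupE G : maximal_subgroup G ->
  exists e, idem e /\ G = unit_group e.
Proof.
case=> -[_ [e [Ge e1 einv]]] maxG; exists e.
have ee : idem e by have [] := e1 _ Ge.
split=> //; apply/esym/maxG; first exact: subgroup_unit_group.
move=> x Gx; have [ex xe] := e1 _ Gx; split=> //.
by have [y [Gy xy yx]] := einv _ Gx; have [ey ye] := e1 _ Gy; exists y.
Qed.

End Idempotents.

(** Left multiplication by [b] is injective on the elements fixed by left multiplication by [f],
    because [a * b = f], hence surjective by finiteness. The preimage of [f] must be [a]. *)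
Lemma fin_Dedekind (S : finSemigroupType) (a b f : S) :
  f * a = a -> a * f = a -> f * b = b -> a * b = f -> b * a = f.
Proof.
move=> fa af fb ab; pose D := finset (fun x : S => f * x == x).
have bD : (fun x => b * x) @: D = D.
  apply/eqP; rewrite eqEcard; apply/andP; split.
    apply/fintype.subsetP => _ /imsetP[x _ ->].
    by rewrite inE mulgA fb.
  rewrite card_in_imset // => x y; rewrite !inE => /eqP fx /eqP fy bxy.
  by rewrite -fx -fy -ab -!mulgA bxy.
have ff : f * f = f by rewrite -{2}ab mulgA fa ab.
have : f \in D by rewrite inE ff.
rewrite -bD => /imsetP[x]; rewrite inE => /eqP fx bx.
have <- : x = a by rewrite -fx -ab -mulgA -bx af.
by rewrite -bx.
Qed.

Section TopologicalIsomorphism.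
Variable V : semigroup_class.

(* Isomorphisms induced by globally defined continuous maps, which compose
   without any restriction to subspaces. *)
Definition cont_iso (A B : choiceType) (G : set (freepro V A)) (H : set (freepro V B)) :=
  exists f g, [/\ continuous f /\ continuous g, set_fun G H f, set_fun H G g,
    {in G, cancel f g} /\ {in H, cancel g f} & {in G &, {morph f : x y / x * y}}].

Lemma cont_iso_profinite (A B : choiceType) (G : set (freepro V A))
    (H : set (freepro V B)) : cont_iso G H -> profinite_iso G H.
Proof.
case=> f [g [[cf cg] fG gH fg fM]]; exists f, g; split=> //.
by split=> //; exact: continuous_subspaceT.
Qed.

Lemma cont_iso_refl (A : choiceType) (G : set (freepro V A)) : cont_iso G G.
Proof. by exists id, id; split=> //; split=> x. Qed.

Lemma cont_iso_trans (A B C : choiceType) (G : set (freepro V A))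
    (H : set (freepro V B)) (I : set (freepro V C)) :
  cont_iso G H -> cont_iso H I -> cont_iso G I.
Proof.
case=> f [g [[cf cg] fG gH [fK gK] fM]] [f' [g' [[cf' cg'] fH gI [fK' gK'] fM']]].
exists (f' \o f), (g \o g'); split.
- split=> x; apply: continuous_comp; first exact: cf.
  + exact: cf'.
  + exact: cg'.
  + exact: cg.
- by move=> x /fG /fH.
- by move=> x /gI /gH.
- split=> x xin; rewrite /= ?fK' ?fK ?gK ?gK' //; apply/mem_set.
    exact/fG/set_mem.
  exact/gI/set_mem.
- move=> x y xG yG /=; rewrite fM // fM' //; apply/mem_set/fG/set_mem => //.
Qed.

(** The inverse of [u |-> s u t] is [v |-> e t v s e]; the outer factors [e] make it land in the
    local monoid at [e]. *)
Lemma unit_group_conj (pvV : pseudovariety V) (A : choiceType)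
    (e f s t : freepro V A) : idem e -> t * s = e -> f = s * e * t ->
  exists psi, [/\ continuous psi, set_fun (unit_group f) (unit_group e) psi,
    set_fun (unit_group e) (unit_group f) (fun u => s * u * t) &
    [/\ {in unit_group e &, {morph (fun u => s * u * t) : u v / u * v}},
        {in unit_group e, cancel (fun u => s * u * t) psi} &
        {in unit_group f, cancel psi (fun u => s * u * t)}]].
Proof.
move=> ee ts fE.
have ts' a : a * t * s = a * e by rewrite -mulgA ts.
have ee' a : a * e * e = a * e by rewrite -mulgA ee.
have see := ee' s.
have ses : s * e * t * s = s * e by rewrite ts' see.
have ff : f * f = f by rewrite fE !mulgA ses see.
exists (fun v => e * t * v * (s * e)).
have phiM u v : u * e = u -> s * u * t * (s * v * t) = s * (u * v) * t.
  by move=> ue; rewrite !mulgA ts' -(mulgA s u e) ue.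
have psiM u v : u * f = u -> f * v = v ->
    e * t * u * (s * e) * (e * t * v * (s * e)) = e * t * (u * v) * (s * e).
  move=> uf fv; rewrite -[in RHS]uf fE !mulgA.
  by rewrite ee'.
have psif : e * t * f * (s * e) = e.
  by rewrite fE !mulgA !ts' ?(ee', ee).
have psil v : e * (e * t * v * (s * e)) = e * t * v * (s * e).
  by rewrite !mulgA ee.
have psir v : e * t * v * (s * e) * e = e * t * v * (s * e).
  by rewrite -!mulgA ee.
split.
- exact: mullr_continuous.
- move=> u [eu ue [v [ev ve uv vu]]]; split=> //.
  by exists (e * t * v * (s * e)); split; rewrite ?psiM ?uv ?vu.
- move=> u [eu ue [v [ev ve uv vu]]]; rewrite fE; split.
  + by rewrite phiM // eu.
  + by rewrite phiM // ue.
  + by exists (s * v * t); split; rewrite phiM ?ev ?ve ?uv ?vu.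
split.
- by move=> u v /set_mem[_ ue _] _; rewrite phiM.
- move=> x /set_mem [ex xe _].
  by rewrite !mulgA !ts' ee ee' ex xe.
- by move=> x /set_mem [fx xf _]; rewrite -[RHS]fx -[in RHS]xf fE !mulgA.
Qed.

Lemma freepro_Dedekind (A : choiceType) (a b f : freepro V A) :
  f * a = a -> a * f = a -> f * b = b -> a * b = f -> b * a = f.
Proof.
move=> fa af fb ab; apply: val_inj; apply: functional_extensionality_dep => r.
rewrite -[LHS]/(freepro_proj r (b * a)) -[RHS]/(freepro_proj r f).
have [S [h [_ _ rE]]] := vcongP r.
pose H (u : freepro V A) := h (repr (freepro_proj r u)).
have HE u v : H u = H v -> freepro_proj r u = freepro_proj r v.
  move=> uv; rewrite -[LHS]reprK -[RHS]reprK; apply/quo_piP.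
  by rewrite rE; apply/eqP.
have HM u v : H (u * v) = H u * H v.
  rewrite /H -gmulfM; apply/eqP; rewrite -rE; exact: repr_pi.
apply: HE; rewrite HM; apply: fin_Dedekind; rewrite -HM.
- by rewrite fa.
- by rewrite af.
- by rewrite fb.
- by rewrite ab.
Qed.

(** Writing [e = x f y], the elements [s = f y e] and [t = e x f] satisfy [t s = e], so [s t] is an
    idempotent below [f]. That it equals [f] is a form of stability, obtained from
    [freepro_Dedekind]. *)
Lemma idem_Jclass_iso (pvV : pseudovariety V) (A : choiceType) (e f : freepro V A) :
  idem e -> idem f -> Jle e f -> Jle f e -> cont_iso (unit_group e) (unit_group f).
Proof.
move=> ee ff /(Jle_idem ee)[x [y exy]] fe.
have [s [t [ts ses fs tf]]] : exists s t,
    [/\ t * s = e, s * e = s, f * s = s & t * f = t].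
  exists (f * y * e), (e * x * f); split.
  - rewrite !mulgA -(mulgA _ f f) ff -(mulgA e x f) -(mulgA e _ y) -exy ee.
    exact: ee.
  - by rewrite -mulgA ee.
  - by rewrite !mulgA ff.
  - by rewrite -mulgA ff.
suff fst : f = s * e * t.
  have [psi [cpsi psif phie [phiM phiK psiK]]] := unit_group_conj pvV ee ts fst.
  exists (fun u => s * u * t), psi; split=> //; split=> //.
  exact: mullr_continuous.
rewrite ses.
have /(Jle_idem ff)[p [q fpq]] := fe.
(* Since [f = p e q], one has [a * b = f], and then [b * a = f]. As [s * t] fixes [b] on the left it
   fixes [f], and [t * f = t] gives [s * t = f]. *)
pose a := f * p * t; pose b := s * q * f.
have st : s * t * s = s by rewrite -mulgA ts ses.
have fa : f * a = a by rewrite /a !mulgA ff.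
have af : a * f = a by rewrite /a -mulgA tf.
have fb : f * b = b by rewrite /b !mulgA fs.
have ab : a * b = f.
  rewrite /a /b !mulgA -(mulgA _ t s) ts -(mulgA f p e) -(mulgA f _ q) -fpq.
  by rewrite ff ff.
have ba : b * a = f by exact: freepro_Dedekind.
have gb : s * t * b = b by rewrite /b !mulgA st.
by rewrite -ba -{1}gb -mulgA ba -mulgA tf.
Qed.

End TopologicalIsomorphism.

(** * Extension of transductions to pseudowords *)

Section Limits.
Variable V : semigroup_class.
Hypotheses (pvV : pseudovariety V) (monV : monoidal V) (LSlV : subclass LSl V).
Hypothesis VD : forall S, V S <-> pv_semidirect V DD S.
Variables (A : finType) (b : bool) (L : seq A -> Prop).
Hypothesis plL : prolongable L.
Implicit Types (r : vcong V A) (p s : seq A) (e u v : freepro V A) (w z : word A).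

Lemma rec_suffix (q : seq A) : recognizable V (fun w : word A => suffix q w).
Proof.
have [r rP] := rec_lastn pvV monV LSlV VD A (size q).
by exists r => w z /rP e /=; rewrite !suffix_lastn e.
Qed.

Lemma rec_size n : recognizable V (fun w : word A => n <= size w)%N.
Proof.
have [r rP] := rec_lastn pvV monV LSlV VD A n; exists r => w z /rP e nw.
by have := congr1 size e; rewrite !size_lastn; lia.
Qed.

Lemma rec_loc n : recognizable V (fun w : word A => loc L n w).
Proof.
have [r rP] := rec_infix pvV monV LSlV VD A n; exists r => w z /rP e Lw x xz xn.
by apply: Lw => //; rewrite (e x xn).
Qed.

(** The contexts [p] and [s] are letters that may be put around the approximating words; they later
    supply a history for a transducer and a margin for its delay. *)
Definition limits p s u := forall n r, exists2 w : word A,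
  language_family b L n (p ++ w ++ s) & approx r u w.

Lemma limits_extend1 (ext : A -> seq A * seq A) u :
  (forall a, exists n r, forall w : word A, approx r u w ->
     ~ language_family b L n ((ext a).1 ++ w ++ (ext a).2)) ->
  exists n r, forall a (w : word A), approx r u w ->
     ~ language_family b L n ((ext a).1 ++ w ++ (ext a).2).
Proof.
move=> H; have [m mP] := choice H.
have [|t tP] := vcong_meets pvV (enum A) mP.
  by move=> a r t tr rP w uw; apply: rP; exact: approx_sub uw.
exists (\max_a m a), t => a w uw; have aA : a \in enum A by rewrite mem_enum.
by move/(familyW (leq_bigmax a)); exact: tP aA _ uw.
Qed.

(** If every letter failed, finiteness of the alphabet would give one order and one precision at
    which all fail, against prolongability at a single approximating word. *)
Lemma limits_left p s u : limits p s u -> exists a, limits (a :: p) s u.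
Proof.
move=> lim; apply/not_existsP => H.
have [|n [r nrP]] := @limits_extend1 (fun a => (a :: p, s)) u.
  move=> a; have /existsNP[n /existsNP[r nP]] := H a; exists n, r => w uw Lw.
  by apply: nP; exists w.
have [w Lw uw] := lim n r.
by have [a La] := pl_left (family_prolongable b plL n) Lw; apply: nrP La.
Qed.

Lemma limits_right p s u : limits p s u -> exists a, limits p (rcons s a) u.
Proof.
move=> lim; apply/not_existsP => H.
have [|n [r nrP]] := @limits_extend1 (fun a => (p, rcons s a)) u.
  move=> a; have /existsNP[n /existsNP[r nP]] := H a; exists n, r => w uw Lw.
  by apply: nP; exists w.
have [w Lw uw] := lim n r.
have [a La] := pl_right (family_prolongable b plL n) Lw.
by apply: (nrP a) uw _; rewrite -!rcons_cat.
Qed.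

Lemma limits_extend n m u : limits [::] [::] u ->
  exists p s, [/\ size p = n, size s = m & limits p s u].
Proof.
move=> lim.
have [p [sp limp]] : exists p, size p = n /\ limits p [::] u.
  elim: n => [|n [p [<- /limits_left[a lima]]]]; first by exists [::].
  by exists (a :: p).
have [s [ss lims]] : exists s, size s = m /\ limits p s u.
  elim: m => [|m [s [<- /limits_right[a lima]]]]; first by exists [::].
  by exists (rcons s a); rewrite size_rcons.
by exists p, s.
Qed.

Lemma limits_cat p s u (x y : word A) : limits (p ++ x) (y ++ s) u ->
  limits p s (freepro_word V x * u * freepro_word V y).
Proof.
move=> lim n r; have [w Lw uw] := lim n r; exists (x * w * y).
  by rewrite /= -!catA in Lw *.
by do 2?apply: approxM.
Qed.

Lemma near_limits p s u n : limits p s u -> near_words u (fun w => loc L n w).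
Proof.
move=> lim; apply: near_rec (rec_loc n) _ => r; have [w Lw uw] := lim n r.
by exists w => //; apply: loc_infix (family_loc plL Lw); exact: infix_infix.
Qed.

Lemma near_Jle (P : seq A -> Prop) u v :
  recognizable V (fun w : word A => P w) -> (forall x w, infix x w -> P w -> P x) ->
  Jle u v -> near_words u (fun w => P w) -> near_words v (fun w => P w).
Proof.
move=> recP Pinf [x [y uE]] uP; apply: near_rec recP _ => r.
have [s sP] := uP; have [t [tr ts]] := vcong_meet pvV r s.
have [w vw] := approx_ex t v; exists w; first exact: approx_sub vw.
have [z zw uz] : exists2 z : word A, infix w z & approx t u z.
  case: x y uE => [x|] [y|] /= ->.
  - have [x' xx] := approx_ex t x; have [y' yy] := approx_ex t y.
    by exists (x' * (w * y')); [exact: infix_infix|do 2?apply: approxM].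
  - have [x' xx] := approx_ex t x.
    by exists (x' * w); [exact: suffix_infix|apply: approxM].
  - have [y' yy] := approx_ex t y.
    by exists (w * y'); [exact: prefix_infix|apply: approxM].
  - by exists w => //; exact: infix_refl.
by apply: Pinf zw _; apply: sP; exact: approx_sub uz.
Qed.

(** [w * w] approximates the idempotent too; its second half is a copy of [w] read after a history
    that ends in [w]. *)
Lemma near_idem e (P : word A -> Prop) : idem e -> near_words e P ->
  forall r, exists2 w, approx r e w & P w /\ P (w * w).
Proof.
move=> ee [s sP] r; have [t [tr ts]] := vcong_meet pvV r s.
have [w ew] := approx_ex t e; exists w; first exact: approx_sub ew.
split; apply: sP; first exact: approx_sub ew.
by rewrite -ee; apply: approxM; exact: approx_sub ew.
Qed.

Lemma idem_size e n : idem e -> near_words e (fun w => n <= size w)%N.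
Proof.
move=> ee; elim: n => [|n IHn]; first by have [r _] := vcong_top pvV A; exists r.
rewrite -ee; apply: (near_mul pvV (rec_size n.+1) IHn IHn).
move=> w z nw nz; rewrite /= size_cat; case: z nz => -[|a z] //= _ _.
by rewrite addnS ltnS (leq_trans nw) // leq_addr.
Qed.

Lemma idem_suffix e n : idem e ->
  exists q, size q = n /\ near_words e (fun w => suffix q w).
Proof.
move=> ee; have [r rP] := rec_lastn pvV monV LSlV VD A n.
have [w ew nw] := near_ex pvV r (idem_size n ee).
exists (lastn n w); split; first by rewrite size_lastn; apply/minn_idPl.
exists r => z ez; rewrite (rP w z); first exact: suffix_drop.
exact: approx_cong ew ez.
Qed.

Lemma near_mulr_suffix e u (q : seq A) : near_words e (fun w => suffix q w) ->
  u * e = u -> near_words u (fun w => suffix q w).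
Proof.
move=> eq ue; rewrite -ue.
have [r0 _] := vcong_top pvV A.
have uT : near_words u (fun _ => True) by exists r0.
by apply: (near_mul pvV (rec_suffix q) uT eq) => w z _; exact: suffix_catr.
Qed.

End Limits.

Lemma cat_injr (T : Type) (s1 s2 s : seq T) : s1 ++ s = s2 ++ s -> s1 = s2.
Proof.
move=> e; have es : size s1 = size s2.
  by have := congr1 size e; rewrite !size_cat; lia.
by rewrite -[LHS](take_size_cat s erefl) e es take_size_cat.
Qed.

(** * The homomorphism that a transduction induces on a maximal subgroup *)

Section Passage.
Variable V : semigroup_class.
Hypotheses (pvV : pseudovariety V) (monV : monoidal V) (LSlV : subclass LSl V).
Hypothesis VD : forall S, V S <-> pv_semidirect V DD S.
Variables (A B : finType) (b : bool) (LX : seq A -> Prop) (LY : seq B -> Prop).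
Hypotheses (plX : prolongable LX) (plY : prolongable LY).
Variables (K g : nat) (tau : seq A -> A -> seq B) (b0 : B).
Hypothesis tauP : transduces LX LY K g tau.
Variable Phi : seq A -> freepro V A -> freepro V B.
Hypothesis PhiP : forall h, extends (fun w : word A => runw tau b0 h w) (Phi h).

Let tauK := td_mem tauP.

(** The history of the second factor ends in [q], which covers the memory. Nonempty outputs keep the
    junk value of [runw] out. *)
Lemma Phi_mul h q (u v : freepro V A) : (K <= size q)%N ->
  near_words u (fun w => run tau h w <> [::]) ->
  near_words u (fun w => suffix q w) ->
  near_words v (fun w => run tau q w <> [::]) ->
  Phi h (u * v) = Phi h u * Phi q v.
Proof.
move=> Kq uh uq vq; apply: freepro_eq => s.
have [r1 P1] := PhiP h s; have [r2 P2] := PhiP q s.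
have [r [r_1 r_2]] := vcong_meet pvV r1 r2.
have [w uw [hw /suffixP[w' qw]]] := near_ex pvV r (near_and pvV uh uq).
have [z vz qz] := near_ex pvV r vq.
have e : runw tau b0 h (w * z) = runw tau b0 h w * runw tau b0 q z.
  have hwz : run tau h (w ++ z) = run tau h w ++ run tau q z.
    by rewrite run_cat {2}qw catA (run_suffix _ _ tauK).
  apply: val_inj; rewrite [LHS]runwE hwz.
    by rewrite [RHS]/= !runwE.
  by case: (run tau h w) hw.
exists (runw tau b0 h (w * z)); split.
  by apply/P1/(approx_sub r_1); exact: approxM.
by rewrite e; apply: approxM; [apply/P1/(approx_sub r_1)|apply/P2/(approx_sub r_2)].
Qed.

Lemma Phi_limits p s u : (K <= size p)%N -> limits b LX p s u ->
  near_words u (fun w => run tau p w <> [::]) -> limits b LY [::] [::] (Phi p u).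
Proof.
move=> Kp lim up n t; have [N NP] := run_family b n plY tauP.
have [r rP] := PhiP p t; have [r' r'P] := up.
have [r0 [r0r r0r']] := vcong_meet pvV r r'; have [w Lw uw] := lim N r0.
exists (runw tau b0 p w); last by apply/rP/(approx_sub r0r).
rewrite cats0 runwE; last by apply/r'P/(approx_sub r0r').
apply: NP => //; apply: (pl_infix (family_prolongable b plX N)) Lw.
by rewrite catA prefix_infix.
Qed.

Variables (e : freepro V A) (Q : seq A).
Hypotheses (ee : idem e) (eloc : forall n, near_words e (fun w => loc LX n w)).
Hypotheses (eQ : near_words e (fun w => suffix Q w)) (KQ : (K <= size Q)%N).

(** Near [e] one may read [w * w]. The second [w] comes after the suffix [Q], so its output does not
    depend on [h]; it is nonempty since [Q w] is a factor of [w w] and [w] has at least [g]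
    letters. *)
Lemma idem_runs_neq0 : near_words e (fun w => forall h, run tau h w <> [::]).
Proof.
apply: near_rec (rec_runs_neq0 pvV monV LSlV VD b0 tauK) _ => r.
have near_e := near_and pvV (near_and pvV eQ (eloc (K + g)))
                 (idem_size pvV monV LSlV VD g ee).
have [w ew [[[Qw _] gw] [[_ Lww] _]]] := near_idem pvV ee near_e r.
exists (w * w); first by rewrite -ee; apply: approxM.
move=> h; rewrite /= run_cat; have [w' wE] := suffixP Qw.
rewrite {2}wE catA (run_suffix _ _ tauK) //.
suff : run tau Q w <> [::] by case: (run tau h w) => //.
apply: (run_loc_neq0 tauP (leqnn _)) => //.
by apply: loc_infix Lww; rewrite /= {2}wE -catA suffix_infix.
Qed.

Lemma Jle_runs_neq0 u :
  Jle u e -> near_words u (fun w => forall h, run tau h w <> [::]).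
Proof.
move=> /(Jle_idemr ee)[x [y ->]].
apply: near_rec (rec_runs_neq0 pvV monV LSlV VD b0 tauK) _ => r.
have [w ew wnz] := near_ex pvV r idem_runs_neq0.
have [x' xx] := approx_ex r x; have [y' yy] := approx_ex r y.
exists (x' * w * y'); first by do 2?apply: approxM.
move=> h; rewrite /= !run_cat; have := wnz (h ++ x').
by case: (run tau h x') => //; case: (run tau _ w).
Qed.

Lemma Jle_run_neq0 u h : Jle u e -> near_words u (fun w => run tau h w <> [::]).
Proof. by move=> /Jle_runs_neq0; apply: near_sub => w; exact. Qed.

Lemma theta_mul h x v : Jle v e -> Phi h (x * e * v) = Phi h (x * e) * Phi Q v.
Proof.
move=> ve; apply: Phi_mul => //.
- exact/Jle_run_neq0/Jle_mull.
- by apply: (near_mulr_suffix pvV monV LSlV VD eQ); rewrite -mulgA ee.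
- exact: Jle_run_neq0.
Qed.

Lemma thetaM u v : u * e = u -> e * v = v -> Phi Q (u * v) = Phi Q u * Phi Q v.
Proof.
by move=> ue ev; rewrite -ue theta_mul // -ev; exact: Jle_mulr.
Qed.

Lemma theta_idem : idem (Phi Q e).
Proof. by rewrite /idem -thetaM // ee. Qed.

Lemma theta_unit_group u : unit_group e u -> unit_group (Phi Q e) (Phi Q u).
Proof.
case=> eu ue [v [ev ve uv vu]]; split; first by rewrite -thetaM // eu.
  by rewrite -thetaM // ue.
by exists (Phi Q v); split; rewrite -thetaM // ?ev ?ve ?uv ?vu.
Qed.

(** Prolonging to the left provides a history [p] of length [K] for which [Phi p w0] is again a
    limit. As [w0 = x e y], repeating [e] and splitting twice exhibits [Phi Q e] as a factor of
    [Phi p w0]. *)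
Lemma theta_limits w0 : limits b LX [::] [::] w0 -> Jle w0 e ->
  exists2 w1, limits b LY [::] [::] w1 & Jle w1 (Phi Q e).
Proof.
move=> /(limits_extend pvV plX K 0)[p [s [sp _ lim]]] w0e.
exists (Phi p w0).
  by apply: Phi_limits lim _; [rewrite sp|exact: Jle_run_neq0].
have [x [y ->]] := Jle_idemr ee w0e.
have -> : x * e * y = x * e * (e * (e * y)) by rewrite !mulgA -!(mulgA x) !ee.
rewrite theta_mul; last exact: Jle_mulr.
rewrite -{2}ee theta_mul; last exact: Jle_mulr.
by rewrite ee mulgA; exact: Jle_mul.
Qed.

End Passage.

(** * Composites of two opposite transductions *)

Section RoundTrip.
Variable V : semigroup_class.
Hypotheses (pvV : pseudovariety V) (monV : monoidal V) (LSlV : subclass LSl V).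
Hypothesis VD : forall S, V S <-> pv_semidirect V DD S.
Variables (A B : finType) (LX : seq A -> Prop) (LY : seq B -> Prop).
Hypotheses (plX : prolongable LX) (plY : prolongable LY).
Variables (K g : nat) (tau : seq A -> A -> seq B) (gam : seq B -> B -> seq A).
Variables (a0 : A) (b0 : B).
Hypotheses (tauP : transduces LX LY K g tau) (gamP : transduces LY LX K g gam).
Variable Phi : seq A -> freepro V A -> freepro V B.
Variable Gam : seq B -> freepro V B -> freepro V A.
Hypothesis PhiP : forall h, extends (fun w : word A => runw tau b0 h w) (Phi h).
Hypothesis GamP : forall h, extends (fun w : word B => runw gam a0 h w) (Gam h).

Let tauK := td_mem tauP.
Let gamK := td_mem gamP.

Variables (e : freepro V A) (Q : seq A).
Hypotheses (ee : idem e) (eloc : forall n, near_words e (fun w => loc LX n w)).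
Hypotheses (eQ : near_words e (fun w => suffix Q w)) (KQ : (K <= size Q)%N).

(** The limit [v] is enlarged to [v'] so that [gam] yields a limit for [LX], which is a factor of
    [e]. Apply [tau] to this factorisation: by the delay identity, words near [v] reappear inside
    words near [Phi Q e], and [split_middle] passes to the limit. *)
Lemma theta_minimal b rho : delays LY K gam tau rho ->
  (forall u, limits b LX [::] [::] u -> Jle e u) ->
  forall v, limits b LY [::] [::] v -> Jle (Phi Q e) v.
Proof.
move=> rhoP emin v limv.
(* On the left, [K] letters are the history for [gam], and the others make it output more than [K]
   letters, the memory of [tau]. On the right, [S] is long enough to contain what the delay holds
   back. The extra letters keep these words nonempty. *)
have [P [S [sP sS lim]]] :=
  limits_extend pvV plY (K + (K.+1 * g).+1) (K + g).+1 limv.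
pose z1 := take K P; pose z2 := drop K P.
have Pz : P = z1 ++ z2 by rewrite cat_take_drop.
have sz1 : size z1 = K by rewrite size_take_min; lia.
have sz2 : size z2 = (K.+1 * g).+1 by rewrite size_drop; lia.
clearbody z1 z2; subst P.
have loczS n w : language_family b LY n ((z1 ++ z2) ++ w ++ S) ->
    loc LY n (z1 ++ z2 ++ w ++ S).
  by move/(family_loc plY); rewrite -catA.
have [Z2 Z2E] : exists Z2 : word B, wseq Z2 = z2.
  by apply: word_of_seq => z20; rewrite z20 in sz2.
have [SW SWE] : exists SW : word B, wseq SW = S.
  by apply: word_of_seq => S0; rewrite S0 in sS.
pose v' := freepro_word V Z2 * v * freepro_word V SW.
have limu : limits b LX [::] [::] (Gam z1 v').
  apply: (Phi_limits pvV plY plX gamP GamP (s := [::])).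
  - by rewrite sz1.
  - by apply: limits_cat; rewrite Z2E SWE cats0.
  apply: near_rec (rec_run_neq0 pvV monV LSlV VD a0 gamK z1) _ => r.
  have [w /loczS Lw vw] := lim (K + g)%N r.
  exists (Z2 * w * SW); first by do 2?apply: approxM.
  apply: (run_loc_neq0 gamP (leqnn _)); rewrite /= ?sz1 ?Z2E ?SWE -?catA //.
  by rewrite !size_cat sz2; nia.
have [x [y exy]] := Jle_idem ee (emin _ limu).
suff [p [q ->]] : exists p q, Phi Q e = p * v * q by exact: Jle_mul.
apply: split_middle => // s.
have [r rP] := PhiP Q s; have [r1 r1P] := GamP z1 r.
have [s' [s'r1 s's]] := vcong_meet pvV r1 s.
have [w /loczS Lw vw] := lim (K + K * g + g).+1 s'.
have [x' xx'] := approx_ex r x; have [y' yy'] := approx_ex r y.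
have [e' ee' e'nz] := near_ex pvV r
  (idem_runs_neq0 pvV monV LSlV VD b0 tauP ee eloc eQ KQ).
(* The copies of [e'] at both ends make the outputs around the central factor nonempty. *)
pose U := runw gam a0 z1 (Z2 * w * SW); pose E := e' * (x' * U * y') * e'.
have eE : approx r e E.
  rewrite -[e]ee -[X in X * e]ee {2}exy; do 2?apply: approxM => //.
  by do 2?apply: approxM => //; apply/r1P; do 2?apply: approxM => //;
     exact: approx_sub vw.
pose Z := run gam z1 z2.
have KZ : (K < size Z)%N.
  apply: (run_loc_size gamP (N := (K + K * g + g).+1)); rewrite ?sz1 ?sz2 ?leqnSn //.
    by lia.
  by apply: loc_infix Lw; rewrite catA prefix_infix.
have UE : wseq U = Z ++ run gam (z1 ++ z2) (w ++ S).
  rewrite runwE /= Z2E SWE -catA run_cat //.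
  by rewrite -/Z; case: (Z) KZ.
have [S' SE] : exists S', S = S' ++ rho S by have /suffixP := dl_suffix rhoP S.
(* After the history [Z], [tau] restores [w] in full: what was held back before [w] comes out first,
   and what remains held back lies within [S]. *)
have delay : run tau Z (run gam (z1 ++ z2) (w ++ S)) = rho (z1 ++ z2) ++ w ++ S'.
  have Kz1 : (K <= size z1)%N by rewrite sz1.
  have Kz2 : (K * g <= size z2)%N by rewrite sz2; nia.
  have := run_delay gamP tauK rhoP Kz1 Kz2 Lw.
  have -> : rho (z1 ++ z2 ++ w ++ S) = rho S.
    by rewrite !catA (rho_cat rhoP) // sS; lia.
  by move=> H; apply: (@cat_injr _ _ _ (rho S)); rewrite H -!catA -SE.
have [W1 W1E] : exists W1 : word B,
    wseq W1 = run tau Q (e' ++ x' ++ Z) ++ rho (z1 ++ z2).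
  by apply: word_of_seq; rewrite run_cat; have := e'nz Q; case: (run tau Q e').
pose h := Q ++ e' ++ x' ++ U.
have [W2 W2E] : exists W2 : word B, wseq W2 = S' ++ run tau h (y' ++ e').
  apply: word_of_seq; rewrite run_cat; have := e'nz (h ++ y').
  by case: (S') => //; case: (run tau h y').
exists W1, W2, w; first exact: approx_sub vw.
have EE : wseq E = (e' ++ x' ++ U) ++ y' ++ e' by rewrite /= -!catA.
have runE : run tau Q E = (W1 ++ w) ++ W2.
  rewrite EE run_cat -/h W1E W2E; clearbody h.
  have -> : e' ++ x' ++ U = (e' ++ x' ++ Z) ++ run gam (z1 ++ z2) (w ++ S).
    by rewrite UE -!catA.
  have -> : run tau Q ((e' ++ x' ++ Z) ++ run gam (z1 ++ z2) (w ++ S)) =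
            run tau Q (e' ++ x' ++ Z) ++ rho (z1 ++ z2) ++ w ++ S'.
    rewrite run_cat; congr (_ ++ _).
    have -> : Q ++ e' ++ x' ++ Z = (Q ++ e' ++ x') ++ Z by rewrite -!catA.
    by rewrite (run_suffix _ _ tauK (ltnW KZ)) delay.
  by rewrite -!catA.
have -> : W1 * w * W2 = runw tau b0 Q E.
  apply: val_inj; rewrite [RHS]runwE runE //.
  by case: (W1) => -[].
exact/rP.
Qed.

(** The composite rotates words: [x] followed by [rho Q] becomes [rho Q] followed by [x]. With [s]
    the word [rho Q] and [e = t s], it sends [u = u t s] to [s u t]. If [rho Q] is empty, [s] and
    [t] are both [e]. *)
Lemma round_trip rho Q' : delays LX K tau gam rho ->
  (K + K * g <= size Q)%N -> (K <= size Q')%N ->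
  near_words (Phi Q e) (fun w => suffix Q' w) ->
  exists s t, t * s = e /\
    forall u, unit_group e u -> Gam Q' (Phi Q u) = s * u * t.
Proof.
move=> rhoP KgQ KQ' fQ'.
(* The first [K] letters are history; the other letters, at least [K * g], make [tau] output the [K]
   letters that [gam] remembers. *)
pose q := take K Q; pose z := drop K Q.
have QE : Q = q ++ z by rewrite cat_take_drop.
have sq : size q = K by rewrite size_take_min; lia.
have sz : (K * g <= size z)%N by rewrite size_drop; lia.
clearbody q z.
pose N := (K + K * g + g).+1.
have locQ : loc LX N Q.
  have [r0 _] := vcong_top pvV A.
  have [w _ [/suffixW Qw Lw]] := near_ex pvV r0 (near_and pvV eQ (eloc N)).
  exact: loc_infix Lw.
pose R := run tau q z.
have KR : (K <= size R)%N.
  apply: (run_loc_size tauP (N := N)); rewrite ?sq -?QE //.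
  by rewrite /N; lia.
have enz := idem_runs_neq0 pvV monV LSlV VD b0 tauP ee eloc eQ KQ.
have fR : near_words (Phi Q e) (fun w => suffix R w).
  apply: near_rec (rec_suffix pvV monV LSlV VD R) _ => s.
  have [r rP] := PhiP Q s.
  have [w ew [/suffixP[w' wE] wnz]] := near_ex pvV r (near_and pvV eQ enz).
  exists (runw tau b0 Q w); first exact: rP.
  rewrite runwE // wE QE catA run_cat suffix_catr // !catA.
  by rewrite (run_suffix _ _ tauK) ?sq // suffix_refl.
(* [Q'] and [R] are suffixes of a common word near [Phi Q e], so [gam] cannot tell them apart as
   histories. *)
have lastQR : lastn K Q' = lastn K R.
  have [s0 _] := vcong_top pvV B.
  have [w _ [/suffixP[x ->] /suffixP[y]]] := near_ex pvV s0 (near_and pvV fQ' fR).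
  by move/(congr1 (lastn K)); rewrite !lastn_cat.
have runQ' w : run gam Q' w = run gam R w.
  by rewrite (run_mem Q' _ gamK) lastQR -run_mem.
have delay (w : word A) x : wseq w = x ++ rho Q -> suffix Q w -> loc LX N (Q ++ w) ->
    run gam Q' (run tau Q w) = rho Q ++ x.
  move=> wx /suffixP[w' wQ] Lw; have Kq : (K <= size q)%N by rewrite sq.
  apply: (@cat_injr _ _ _ (rho Q)); rewrite -catA -wx runQ' {1 3}QE.
  rewrite -(run_delay tauP gamK rhoP Kq sz) ?catA -?QE //; congr (_ ++ _).
  by rewrite wQ catA (rho_cat rhoP).
(* For the locality of [Q w], take [x] near [e]: it ends in [Q], and [x w] is still near
   [u = e u]. *)
have near_u u : unit_group e u -> near_words u (fun w =>
    [/\ suffix Q w, loc LX N (Q ++ w) & forall h, run tau h w <> [::]]).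
  move=> ue; have [u1 u2] := unit_group_Jle ue.
  have uloc : near_words u (fun w => loc LX N w).
    apply: near_Jle (rec_loc pvV monV LSlV VD LX N) _ u2 (eloc N) => //.
    by move=> x w xw; exact: loc_infix.
  have unz := Jle_runs_neq0 pvV monV LSlV VD b0 tauP ee eloc eQ KQ u1.
  have {}uQ := near_mulr_suffix pvV monV LSlV VD eQ (let: And3 _ h _ := ue in h).
  have [r1 P1] := near_and pvV uloc (near_and pvV uQ unz).
  have [r2 P2] := eQ; have [r [r_1 r_2]] := vcong_meet pvV r1 r2.
  exists r => w uw; have [_ [Qw wnz]] := P1 _ (approx_sub r_1 uw).
  split=> //; have [x ex] := approx_ex r e.
  have /suffixP[x' xE] := P2 _ (approx_sub r_2 ex).
  have [|Lxw _] := P1 (x * w).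
    apply: approx_sub r_1 _; have [eu _ _] := ue.
    by rewrite -eu; exact: approxM.
  by apply: loc_infix Lxw; rewrite /= xE -catA suffix_infix.
have image u : unit_group e u -> forall r, exists r', forall (w y : word A) x,
    approx r' u w -> wseq w = x ++ rho Q -> wseq y = rho Q ++ x ->
    approx r (Gam Q' (Phi Q u)) y.
  move=> ue r; have [s sP] := GamP Q' r; have [r1 P1] := PhiP Q s.
  have [r2 P2] := near_u u ue; have [r' [r'1 r'2]] := vcong_meet pvV r1 r2.
  exists r' => w y x uw wE yE; have [Qw Lw wnz] := P2 _ (approx_sub r'2 uw).
  have -> : y = runw gam a0 Q' (runw tau b0 Q w).
    apply: val_inj; rewrite [RHS]runwE (runwE _ (wnz Q)) (delay _ _ wE) // -yE.
    by case: (y) => -[].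
  exact/sP/P1/(approx_sub r'1).
have [S0|/eqP S0] := eqVneq (rho Q) [::].
  exists e, e; split=> // u ue; apply: freepro_eq => r.
  have [r' r'P] := image u ue r; have [t [tr tr']] := vcong_meet pvV r r'.
  have [w uw] := approx_ex t u; exists w; split.
    by apply: (r'P w w w); rewrite ?S0 ?cats0 //; exact: approx_sub uw.
  by have [-> -> _] := ue; exact: approx_sub uw.
have [SW SWE] := word_of_seq S0.
have [t tE] : exists t, e = t * freepro_word V SW.
  apply: split_right => // r.
  have [w ew [/suffixP[w' wE] Qw]] :=
    near_ex pvV r (near_and pvV eQ (idem_size pvV monV LSlV VD (size Q).+1 ee)).
  have /suffixP[Q1 Q1E] := dl_suffix rhoP Q.
  have [x0|x xE] := @word_of_seq _ (w' ++ Q1).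
    move: Qw; rewrite wE Q1E.
    by case: w' {wE} x0 => //= ->; rewrite ltnn.
  exists x, SW => //.
  suff -> : x * SW = w by [].
  by apply: val_inj; rewrite /= xE SWE -catA -Q1E -wE.
exists (freepro_word V SW), t; split=> // u ue; apply: freepro_eq => r.
have [r' r'P] := image u ue r; have [r0 [r0r r0r']] := vcong_meet pvV r r'.
have [w uw] := approx_ex r0 u; have [t' tt'] := approx_ex r0 t.
exists (SW * w * t'); split.
  apply: (r'P (w * t' * SW) _ (w ++ t')); rewrite /= ?SWE ?catA //.
  have [_ <- _] := ue; rewrite tE mulgA.
  by do 2?apply: approxM => //; exact: approx_sub (uw) || exact: approx_sub tt'.
by do 2?apply: approxM => //; exact: approx_sub (uw) || exact: approx_sub tt'.
Qed.

End RoundTrip.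

(** * Transfer of minimal idempotents and their groups *)

Definition minimal_idem (V : semigroup_class) (A : finType) b (L : seq A -> Prop)
    (e : freepro V A) :=
  [/\ idem e, exists2 w, limits b L [::] [::] w & Jle w e &
      forall v, limits b L [::] [::] v -> Jle e v].

Definition linked (A B : eqType) (LX : seq A -> Prop) (LY : seq B -> Prop) :=
  exists K g tau gam rho sig,
    [/\ transduces LX LY K g tau, transduces LY LX K g gam,
        delays LX K tau gam rho & delays LY K gam tau sig].

Lemma linked_sym (A B : eqType) (LX : seq A -> Prop) (LY : seq B -> Prop) :
  linked LX LY -> linked LY LX.
Proof.
by case=> K [g [tau [gam [rho [sig []]]]]]; exists K, g, gam, tau, sig, rho.
Qed.

Section Step.
Variable V : semigroup_class.
Hypotheses (pvV : pseudovariety V) (monV : monoidal V) (LSlV : subclass LSl V).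
Hypothesis VD : forall S, V S <-> pv_semidirect V DD S.

Lemma minimal_idem_loc (A : finType) b (L : seq A -> Prop) (e : freepro V A) n :
  prolongable L -> minimal_idem b L e -> near_words e (fun w => loc L n w).
Proof.
move=> plL [ee [w limw we] _].
apply: near_Jle (rec_loc pvV monV LSlV VD L n) _ we _ => //.
  by move=> x z xz; exact: loc_infix.
exact: near_limits limw.
Qed.

Lemma Phi_exists (A B : finType) K (tau : seq A -> A -> seq B) (b0 : B) :
  has_memory K tau -> exists Phi : seq A -> freepro V A -> freepro V B,
  forall h, extends (fun w : word A => runw tau b0 h w) (Phi h).
Proof.
move=> tauK; have H h : exists Fh : freepro V A -> freepro V B,
      extends (fun w : word A => runw tau b0 h w) Fh.
  by apply: ext_exists => //; exact: (runw_uniform pvV monV LSlV VD b0 tauK h).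
by have [Phi PhiP] := choice H; exists Phi.
Qed.

Section Theta.
Variables (A B : finType) (b : bool) (LX : seq A -> Prop) (LY : seq B -> Prop).
Hypotheses (plX : prolongable LX) (plY : prolongable LY).
Variables (K g : nat) (tau : seq A -> A -> seq B) (gam : seq B -> B -> seq A).
Variables (a0 : A) (b0 : B).
Hypotheses (tauP : transduces LX LY K g tau) (gamP : transduces LY LX K g gam).
Variable Phi : seq A -> freepro V A -> freepro V B.
Variable Gam : seq B -> freepro V B -> freepro V A.
Hypothesis PhiP : forall h, extends (fun w : word A => runw tau b0 h w) (Phi h).
Hypothesis GamP : forall h, extends (fun w : word B => runw gam a0 h w) (Gam h).

Lemma theta_step sig x : delays LY K gam tau sig -> minimal_idem b LX x ->
  exists Q, [/\ near_words x (fun w => suffix Q w), size Q = (K + K * g)%N,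
    minimal_idem b LY (Phi Q x) &
    set_fun (unit_group x) (unit_group (Phi Q x)) (Phi Q)].
Proof.
move=> sigP xmin; have [xx [w limw wx] lex] := xmin.
have xloc n := minimal_idem_loc n plX xmin.
have [Q [sQ xQ]] := idem_suffix pvV monV LSlV VD (K + K * g) xx.
have KQ : (K <= size Q)%N by rewrite sQ leq_addr.
exists Q; split=> //; last first.
  move=> u; exact: (theta_unit_group pvV monV LSlV VD tauP PhiP xx xloc xQ KQ).
split.
- exact: (theta_idem pvV monV LSlV VD tauP PhiP xx xloc xQ KQ).
- have [w1 lw1 w1f] :=
    theta_limits pvV monV LSlV VD plX plY tauP PhiP xx xloc xQ KQ limw wx.
  by exists w1.
- exact: (theta_minimal pvV monV LSlV VD plX plY tauP gamP PhiP GamP xx xloc xQ KQ sigP lex).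
Qed.

Lemma theta_round_trip rho x Q Q' : delays LX K tau gam rho ->
  minimal_idem b LX x -> near_words x (fun w => suffix Q w) ->
  size Q = (K + K * g)%N -> near_words (Phi Q x) (fun w => suffix Q' w) ->
  size Q' = (K + K * g)%N ->
  exists psi, [/\ continuous psi,
    set_fun (unit_group (Gam Q' (Phi Q x))) (unit_group x) psi,
    forall u, unit_group x u -> psi (Gam Q' (Phi Q u)) = u &
    forall v, unit_group (Gam Q' (Phi Q x)) v -> Gam Q' (Phi Q (psi v)) = v].
Proof.
move=> rhoP xmin xQ sQ fQ' sQ'; have [xx _ _] := xmin.
have xloc n := minimal_idem_loc n plX xmin.
have KQ : (K <= size Q)%N by rewrite sQ leq_addr.
have KQ' : (K <= size Q')%N by rewrite sQ' leq_addr.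
have KgQ : (K + K * g <= size Q)%N by rewrite sQ.
have [s [t [ts stE]]] := round_trip pvV monV LSlV VD tauP gamP PhiP GamP
  xx xloc xQ KQ rhoP KgQ KQ' fQ'.
have [psi [cpsi psiG _ [_ phiK psiK]]] :=
  unit_group_conj pvV xx ts (stE _ (unit_group1 xx)).
exists psi; split=> //.
- by move=> u xu; rewrite stE // phiK //; exact: mem_set.
- by move=> v xv; rewrite stE; [exact/psiK/mem_set|exact: psiG].
Qed.

End Theta.

(* With theta1 : H_e -> H_f, theta2 : H_f -> H_e' and theta3 : H_e' -> H_f', both
   theta2 theta1 and theta3 theta2 are bijective, hence so is theta1. *)
Lemma minimal_idem_iso (A B : finType) b (LX : seq A -> Prop) (LY : seq B -> Prop)
    (a0 : A) (b0 : B) (e : freepro V A) :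
  prolongable LX -> prolongable LY -> linked LX LY -> minimal_idem b LX e ->
  exists f : freepro V B,
    minimal_idem b LY f /\ cont_iso (unit_group e) (unit_group f).
Proof.
move=> plX plY [K [g [tau [gam [rho [sig [tauP gamP rhoP sigP]]]]]]] emin.
have [Phi PhiP] := Phi_exists b0 (td_mem tauP).
have [Gam GamP] := Phi_exists a0 (td_mem gamP).
have stepX := theta_step plX plY tauP gamP PhiP GamP sigP.
have stepY := theta_step plY plX gamP tauP GamP PhiP rhoP.
have [Q1 [eQ1 sQ1 fmin theta1]] := stepX b _ emin.
have [Q2 [fQ2 sQ2 e'min theta2]] := stepY b _ fmin.
have [Q3 [e'Q3 sQ3 f'min theta3]] := stepX b _ e'min.
have [psi [cpsi psiG phiK psiK]] :=
  theta_round_trip plX tauP gamP PhiP GamP rhoP emin eQ1 sQ1 fQ2 sQ2.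
have [psi' [_ _ phiK' _]] :=
  theta_round_trip plY gamP tauP GamP PhiP sigP fmin fQ2 sQ2 e'Q3 sQ3.
exists (Phi Q1 e); split=> //; exists (Phi Q1), (psi \o Gam Q2); split.
- split; first exact: extends_continuous (PhiP Q1).
  move=> v; apply: continuous_comp; last exact: cpsi.
  exact: extends_continuous (GamP Q2) _.
- exact: theta1.
- by move=> v /theta2 /psiG.
- split=> u /set_mem uG /=; first exact: phiK.
  (* By [psiK], [u] and [Phi Q1 (psi (Gam Q2 u))] have the same image under [Gam Q2], which is
     injective on the group by [phiK']. *)
  rewrite -[RHS](phiK' _ uG) -[in RHS](psiK _ (theta2 _ uG)) phiK' //.
  by apply/theta1/psiG/theta2.
- move=> u v /set_mem[eu ue _] /set_mem[ev _ _].
  have [ee _ _] := emin; have eloc n := minimal_idem_loc n plX emin.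
  apply: (thetaM pvV monV LSlV VD tauP PhiP ee eloc eQ1 _ ue ev).
  by rewrite sQ1 leq_addr.
Qed.

End Step.

(** * Conjugacy *)

Import GRing.Theory.

Section Segments.
Variable A : choiceType.
Implicit Types (x : biseq A) (i j : int) (m n : nat) (w : seq A).

Definition seg x i n : seq A := [seq (x (i + k%:Z)%R : A) | k <- iota 0 n].

Definition shift i x : biseq A := fun j => x (j + i)%R.

Lemma shiftD i j x : shift i (shift j x) = shift (i + j)%R x.
Proof.
by apply: functional_extensionality_dep => l; rewrite /shift; congr (x _); lia.
Qed.

Lemma shift0 x : shift 0 x = x.
Proof. by apply: functional_extensionality_dep => l; rewrite /shift addr0. Qed.

Lemma size_seg x i n : size (seg x i n) = n.
Proof. by rewrite size_map size_iota. Qed.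

Lemma segS x i n : seg x i n.+1 = (x i : A) :: seg x (i + 1)%R n.
Proof.
rewrite /seg /= addr0; congr (_ :: _); rewrite -(addn0 1%N) iotaDl -map_comp.
by apply: eq_map => k /=; congr (x _); lia.
Qed.

Lemma seg_cat x i m n : seg x i (m + n) = seg x i m ++ seg x (i + m%:Z)%R n.
Proof.
elim: m i => [|m IHm] i; first by rewrite /= addr0.
rewrite addSn !segS IHm /=; congr (_ :: _ ++ seg x _ _); lia.
Qed.

Lemma seg_rcons x i n : seg x i n.+1 = rcons (seg x i n) (x (i + n%:Z)%R : A).
Proof. by rewrite -addn1 seg_cat segS /= cats1. Qed.

Lemma seg_eq x y i j n :
  (forall k, (k < n)%N -> x (i + k%:Z)%R = y (j + k%:Z)%R) -> seg x i n = seg y j n.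
Proof. by move=> e; apply/eq_in_map => k; rewrite mem_iota; exact: e. Qed.

Lemma seg_inj x y i j n k : seg x i n = seg y j n -> (k < n)%N ->
  x (i + k%:Z)%R = y (j + k%:Z)%R.
Proof.
move=> /eq_in_map e kn; apply: e.
by rewrite mem_iota.
Qed.

Lemma seg_shift x i j n : seg (shift j x) i n = seg x (i + j)%R n.
Proof. by apply: eq_map => k; rewrite /shift; congr (x _); lia. Qed.

Lemma lastn_seg K x i n : (K <= n)%N ->
  lastn K (seg x i n) = seg x (i + n%:Z - K%:Z)%R K.
Proof.
move=> Kn; rewrite -{1}(subnK Kn) seg_cat lastn_size ?size_seg //.
by congr (seg x _ _); lia.
Qed.

(** Unlike [language], this contains the empty sequence as soon as [X] is nonempty, which closure
    under factors requires. *)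
Definition lang (X : set (biseq A)) w := exists x i, X x /\ w = seg x i (size w).

Lemma langP (X : set (biseq A)) x i n : X x -> lang X (seg x i n).
Proof. by move=> Xx; exists x, i; rewrite size_seg. Qed.

Lemma lang_cat (X : set (biseq A)) p w : lang X (p ++ w) ->
  exists x i, [/\ X x, p = seg x i (size p) & w = seg x (i + (size p)%:Z)%R (size w)].
Proof.
case=> x [i [Xx e]]; exists x, i; move: e; rewrite size_cat seg_cat => /eqP.
by rewrite eqseq_cat ?size_seg // => /andP[/eqP <- /eqP <-].
Qed.

Lemma lang_prolongable X : prolongable (lang X).
Proof.
split.
- move=> w z /infixP[p [s ->]] /lang_cat[x [i [Xx _ ws]]].
  have /lang_cat[y [j [Xy -> _]]] : lang X (w ++ s) by rewrite ws; exact: langP.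
  exact: langP.
- move=> w [x [i [Xx ->]]]; exists (x (i - 1)%R).
  by rewrite -{2}(subrK 1%R i) -segS; exact: langP.
- move=> w [x [i [Xx wE]]]; exists (x (i + (size w)%:Z)%R).
  by rewrite {1}wE -seg_rcons; exact: langP.
Qed.

Section SubshiftTheory.
Variable X : set (biseq A).
Hypothesis subX : is_subshift X.

Lemma subshift_shift i x : X x -> X (shift i x).
Proof.
have [_ _ sX] := subX.
have Xs y : X y -> X (shift 1 y) by move=> Xy; rewrite -sX; exists y.
have Xp y : X y -> X (shift (-1) y).
  rewrite -{1}sX => -[z Xz <-]; suff -> : shift (-1) (sigma z) = z by [].
  by apply: functional_extensionality_dep => j; rewrite /shift /sigma subrK.
move=> Xx; elim: i => [|n IHn|n IHn]; first by rewrite shift0.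
- by rewrite -addn1 PoszD addrC -shiftD; exact: Xs.
- by rewrite -addn1 PoszD opprD addrC -shiftD; exact: Xp.
Qed.

End SubshiftTheory.
End Segments.

Section Compactness.
Variable A : finType.
Implicit Types (x y : biseq A).

Definition agree (m : nat) x y := forall i : int, (`|i| <= m)%N -> x i = y i.

Lemma biseq_cluster (x : nat -> biseq A) :
  exists y, forall m n, exists2 k, (n <= k)%N & agree m (x k) y.
Proof.
have [U [UU ooU]] := ultraFilterLemma eventually_filter.
have PU := @ultra_proper _ U UU.
have H i : exists a : A, U [set k | x k i = a].
  exact: (ultra_finite (fun k => x k i : A) UU).
have [y yP] := choice H; exists y => m n.
have Un : U [set k | (n <= k)%N] by apply: ooU; exists n.
have Um (s : seq int) : U [set k | forall i, i \in s -> x k i = y i].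
  elim: s => [|j s IHs]; first by apply: filterS filterT.
  apply: filterS2 (yP j) IHs => k kj ks i.
  by rewrite inE => /predU1P[->|/ks].
have [k [nk kP]] := filter_ex (filterI Un
  (Um ([seq (k%:Z)%R | k <- iota 0 m.+1] ++ [seq (- k%:Z)%R | k <- iota 0 m.+1]))).
exists k => // i im; apply: kP; rewrite mem_cat; apply/orP.
case: i im => [l|l] lm; [left|right]; apply/mapP.
  by exists l => //; rewrite mem_iota.
by exists l.+1; rewrite ?NegzE // mem_iota.
Qed.

Lemma nbhs_agree x (P : set (biseq A)) :
  nbhs x P -> exists m, forall y, agree m y x -> P y.
Proof.
pose F := filter_from [set: nat] (fun m => [set y | agree m y x]).
have FF : Filter F.
  apply: filter_from_filter; first by exists 0%N.
  move=> m n _ _; exists (maxn m n) => // y yx; split=> i im; apply: yx.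
    by rewrite leq_max im.
  by rewrite leq_max im orbT.
have /[apply] : F --> x.
  by apply: cvg_discrete_prod => i; exists `|i|%N => // y; apply.
by case=> m _ mP; exists m.
Qed.

Lemma closed_agree (X : set (biseq A)) x : closed X ->
  (forall m, exists2 y, X y & agree m y x) -> X x.
Proof.
move=> cX H; apply: cX => P /nbhs_agree[m mP]; have [y Xy yx] := H m.
by exists y; split=> //; exact: mP.
Qed.

(** The theorem of Curtis, Hedlund and Lyndon. Otherwise there are pairs that agree on ever larger
    windows but differ in the central letter of the image; a cluster point of the first components
    is approached by the second ones too, against continuity there. *)
Lemma block_code (B : choiceType) (X : set (biseq A)) (f : biseq A -> biseq B) :
  closed X -> {within X, continuous f} ->
  exists m, forall x y, X x -> X y -> agree m x y -> f x 0%R = f y 0%R.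
Proof.
move=> cX cf; apply/not_existsP => H.
have {}H m : exists p : biseq A * biseq A,
    [/\ X p.1, X p.2, agree m p.1 p.2 & f p.1 0%R <> f p.2 0%R].
  apply/not_existsP => nP; apply: (H m) => x y Xx Xy xy.
  by apply: contrapT => fxy; apply: (nP (x, y)).
have [p pP] := choice H.
have [z zP] := biseq_cluster (fun n => (p n).1).
have Xz : X z.
  apply: closed_agree => // m; have [k _ kz] := zP m 0%N.
  by exists (p k).1 => //; have [] := pP k.
have [m mP] : exists m, forall x, X x -> agree m x z -> f x 0%R = f z 0%R.
  have fz : nbhs (f z) [set h : biseq B | h 0%R = f z 0%R].
    exact: (@nbhs_discrete_prod int (fun _ => B)).
  have /nbhs_agree[m mP] : nbhs z [set x | X x -> f x 0%R = f z 0%R].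
    have : within X (nbhs z) (f @^-1` [set h : biseq B | h 0%R = f z 0%R]).
      by rewrite (nbhs_subspace_in Xz); exact: cf fz.
    by [].
  by exists m => x Xx xz; exact: mP.
have [k mk kz] := zP m m; have [X1 X2 k12] := pP k; apply.
rewrite (mP _ X1 kz) (mP _ X2) // => i im.
by rewrite -(k12 i) ?(leq_trans im) // kz.
Qed.

End Compactness.

Section SlidingBlockCodes.
Variables (A B : finType) (X : set (biseq A)) (f : biseq A -> biseq B) (m : nat).
Hypothesis subX : is_subshift X.
Hypothesis f_sigma : forall x, X x -> f (sigma x) = sigma (f x).
Hypothesis f_window : forall x y, X x -> X y -> agree m x y -> f x 0%R = f y 0%R.

Lemma code_shift i x : X x -> f (shift i x) = shift i (f x).
Proof.
have Xs j y : X y -> X (shift j y) by exact: subshift_shift.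
have f1 y : X y -> f (shift 1 y) = shift 1 (f y) by exact: f_sigma.
have fN y : X y -> f (shift (-1) y) = shift (-1) (f y).
  move=> Xy; rewrite -[LHS]shift0 -[0%R](addNr 1%R) -shiftD -f1; last exact: Xs.
  by rewrite shiftD subrr shift0.
move=> Xx; elim: i => [|n IHn|n IHn]; first by rewrite !shift0.
- by rewrite -addn1 PoszD addrC -!shiftD f1 ?IHn //; exact: Xs.
- by rewrite -addn1 PoszD opprD addrC -!shiftD fN ?IHn //; exact: Xs.
Qed.

(* The window of the code is [-m, m]; the output is delayed by m. *)
Definition slide (h : seq A) (a : A) : seq B :=
  if pselect (exists x, X x /\ rcons (lastn (m + m) h) a = seg x 0 (m + m).+1)
    is left ex then [:: f (sval (cid ex)) (m%:Z)%R : B] else [::].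

Lemma slide_mem : has_memory (m + m) slide.
Proof. by move=> h a; rewrite /slide lastn_min. Qed.

Lemma slideE x i n : X x -> (m + m <= n)%N ->
  slide (seg x i n) (x (i + n%:Z)%R) = [:: f x (i + n%:Z - m%:Z)%R : B].
Proof.
move=> Xx mn; rewrite /slide lastn_seg //.
set j := (i + n%:Z - (m + m)%N%:Z)%R.
have -> : (i + n%:Z)%R = (j + (m + m)%N%:Z)%R by rewrite /j subrK.
rewrite -seg_rcons; case: pselect => [ex|]; last first.
  case; exists (shift j x); split; first exact: subshift_shift.
  by rewrite seg_shift add0r.
(* The chosen [y] may differ from [x] outside the window; [f_window] at its centre gives the same
   letter. *)
case: (cid ex) => y /= [Xy xy]; congr [:: _].
have <- : f (shift (m%:Z)%R y) 0%R = f y (m%:Z)%R.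
  by rewrite code_shift // /shift add0r.
have -> : f x (j + (m + m)%N%:Z - m%:Z)%R = f (shift (j + m%:Z)%R x) 0%R.
  by rewrite code_shift // /shift; congr (f x _); lia.
apply: f_window; [exact: subshift_shift..|move=> k km; rewrite /shift].
have kK : (`|(k + m%:Z)%R|%N < (m + m).+1)%N by lia.
have := seg_inj xy kK.
have -> : (`|(k + m%:Z)%R|%N%:Z = k + m%:Z)%R by lia.
by rewrite add0r => <-; congr (x _); lia.
Qed.

Lemma run_slide x i n l : X x -> (m + m <= n)%N ->
  run slide (seg x i n) (seg x (i + n%:Z)%R l) = seg (f x) (i + n%:Z - m%:Z)%R l.
Proof.
move=> Xx; elim: l n => [//|l IHl] n mn.
rewrite !segS /= slideE //; congr (_ :: _).
rewrite -seg_rcons -addrA -PoszD addn1 IHl ?leqW //.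
by congr (seg (f x) _ _); lia.
Qed.

Lemma slide_transduces (Y : set (biseq B)) : (forall x, X x -> Y (f x)) ->
  transduces (lang X) (lang Y) (m + m) 1 slide.
Proof.
move=> fXY; split; first exact: slide_mem.
- move=> p w Kp /lang_cat[x [i [Xx pE wE]]]; rewrite pE wE run_slide //.
  by apply: langP; exact: fXY.
- move=> p w Kp w1 /lang_cat[x [i [Xx pE wE]]].
  rewrite pE wE run_slide //; case: (size w) w1 => // n _.
Qed.

End SlidingBlockCodes.

(** Each code is late by [m], so the composite holds back the last [m + m] letters. *)
Lemma slide_delays (A B : finType) (X : set (biseq A)) (Y : set (biseq B))
    (f : biseq A -> biseq B) (g : biseq B -> biseq A) m :
  is_subshift X -> is_subshift Y -> (forall x, X x -> Y (f x)) ->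
  (forall x, X x -> f (sigma x) = sigma (f x)) ->
  (forall y, Y y -> g (sigma y) = sigma (g y)) ->
  (forall x y, X x -> X y -> agree m x y -> f x 0%R = f y 0%R) ->
  (forall x y, Y x -> Y y -> agree m x y -> g x 0%R = g y 0%R) ->
  (forall x, X x -> g (f x) = x) ->
  delays (lang X) (m + m) (slide X f m) (slide Y g m) (lastn (m + m)).
Proof.
move=> subX subY fXY f_sigma g_sigma f_win g_win gf; split.
- by move=> q; rewrite lastn_min.
- by move=> q; exact: suffix_drop.
move=> q z a Kq Kr; rewrite -cats1 catA => /lang_cat[x [i [Xx qzE aE]]].
move: qzE aE; rewrite size_cat seg_cat.
set n := size q in Kq *; set l := size z => /eqP.
rewrite eqseq_cat ?size_seg //; case/andP=> /eqP qE /eqP zE.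
rewrite /= segS => -[aE]; clearbody n l; subst q z a.
have fX i' n' l' := run_slide subX f_sigma f_win i' l' Xx (n := n').
rewrite fX // size_seg in Kr *; rewrite -!seg_cat PoszD addrA.
have slX := slideE subX f_sigma f_win i Xx (n := n + l).
rewrite PoszD addrA in slX; rewrite slX; last by lia.
have -> : (i + n%:Z + l%:Z - m%:Z = i + n%:Z - m%:Z + l%:Z)%R by lia.
rewrite /= slideE //; last exact: fXY.
rewrite gf // -addrA -PoszD cats1 -seg_rcons !lastn_seg; [|lia..].
set j := (i + (n + l)%N%:Z - (m + m)%N%:Z)%R.
have -> : (i + (n + l)%N%:Z)%R = (j + (m + m)%N%:Z)%R by rewrite /j; lia.
rewrite -seg_rcons segS cats0; congr (x _ :: seg x _ _); rewrite /j; lia.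
Qed.

Lemma conjugate_linked (X Y : subshift) : conjugate X Y ->
  linked (lang (points X)) (lang (points Y)).
Proof.
move: X Y => [A X subX] [B Y subY] [f [g [[cf cg fXY gYX [fK gK]] f_sigma]]].
rewrite /= in f g cf cg fXY gYX fK gK f_sigma *.
have [_ clX _] := subX; have [_ clY _] := subY.
have gf x : X x -> g (f x) = x by move=> /mem_set; exact: fK.
have fg y : Y y -> f (g y) = y by move=> /mem_set; exact: gK.
have g_sigma y : Y y -> g (sigma y) = sigma (g y).
  move=> Yy; rewrite -{1}(fg y) // -f_sigma ?gf //; last exact: gYX.
  by apply: (@subshift_shift _ _ subX 1); exact: gYX.
have [m1 f_win1] := block_code clX cf; have [m2 g_win2] := block_code clY cg.
pose m := maxn m1 m2.
have f_win x y : X x -> X y -> agree m x y -> f x 0%R = f y 0%R.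
  move=> Xx Xy xy; apply: f_win1 => // i im; apply: xy.
  by rewrite leq_max im.
have g_win x y : Y x -> Y y -> agree m x y -> g x 0%R = g y 0%R.
  move=> Yx Yy xy; apply: g_win2 => // i im; apply: xy.
  by rewrite leq_max im orbT.
exists (m + m)%N, 1%N, (slide X f m), (slide Y g m), (lastn (m + m)), (lastn (m + m)).
split.
- exact: slide_transduces.
- exact: slide_transduces.
- exact: slide_delays fXY f_sigma g_sigma f_win g_win gf.
- exact: slide_delays gYX g_sigma f_sigma g_win f_win fg.
Qed.

(** * Symbol expansion *)

Section Memoryless.
Variables (A B : eqType) (t : A -> seq B).

Definition memless : seq A -> A -> seq B := fun _ a => t a.

Definition subst (w : seq A) := flatten [seq t a | a <- w].

Lemma run_memless h w : run memless h w = subst w.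
Proof. by elim: w h => //= a w IHw h; rewrite IHw. Qed.

Lemma subst_cons a w : subst (a :: w) = t a ++ subst w.
Proof. by []. Qed.

Lemma subst_cat w z : subst (w ++ z) = subst w ++ subst z.
Proof. by rewrite /subst map_cat flatten_cat. Qed.

Lemma infix_subst w z : infix w z -> infix (subst w) (subst z).
Proof. by move=> /infixP[p [s ->]]; rewrite !subst_cat infix_infix. Qed.

Lemma size_subst w : (forall a, t a <> [::]) -> (size w <= size (subst w))%N.
Proof.
move=> tn; elim: w => //= a w IHw; rewrite subst_cons size_cat -add1n leq_add //.
by have := tn a; case: (t a).
Qed.

End Memoryless.

Lemma nbhs_seg (A : choiceType) (x : biseq A) i n :
  nbhs x [set y | seg y i n = seg x i n].
Proof.
elim: n => [|n IHn]; first by apply: filterS filterT.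
have xn : nbhs x [set y : biseq A | y (i + n%:Z)%R = x (i + n%:Z)%R].
  exact: (@nbhs_discrete_prod int (fun _ => A)).
by apply: filterS2 IHn xn => y /= e1 e2; rewrite !seg_rcons e1 e2.
Qed.

Section SymbolExpansion.
Variables (A : finType) (alpha : A).

Definition exp_letter (a : A) : seq (option A) :=
  if a == alpha then [:: Some a; None] else [:: Some a].

(* Delaying the output of [alpha] until its companion letter has been read makes
   the transduction defined on all factors of the symbol expansion. *)
Definition contract_letter (c : option A) : seq A :=
  if c is Some a then if a == alpha then [::] else [:: a] else [:: alpha].

Lemma expandE (w : word A) : wseq (expand alpha w) = subst exp_letter w.
Proof.
rewrite /= /subst; congr flatten; apply: eq_map => a; rewrite /exp_letter.
by case: ifP.
Qed.

Lemma contract_exp_letter a : subst contract_letter (exp_letter a) = [:: a].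
Proof.
rewrite /exp_letter /subst; case: (eqVneq a alpha) => [->|aN] /=.
  by rewrite eqxx.
by rewrite (negPf aN).
Qed.

Lemma contract_expand w : subst contract_letter (subst exp_letter w) = w.
Proof.
elim: w => // a w IHw.
by rewrite subst_cons subst_cat contract_exp_letter IHw.
Qed.

Definition compatible (x y : option A) := (x == Some alpha) == (y == None).

Lemma exp_compatible w : sorted compatible (subst exp_letter w).
Proof.
suff H h : h != Some alpha -> path compatible h (subst exp_letter w).
  by apply: (@path_sorted _ _ None); exact: H.
elim: w h => // a w IHw h hN; rewrite subst_cons cat_path.
rewrite {1 2}/exp_letter; case: (eqVneq a alpha) => [->|aN] /=.
  by rewrite /compatible (negPf hN) /= !eqxx /= IHw.
rewrite /compatible (negPf hN) /= IHw //.
Qed.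

Variables (X : set (biseq A)) (Y : set (biseq (option A))).
Hypotheses (subX : is_subshift X) (subY : is_subshift Y).
Hypothesis XY : expand alpha @` language X `<=` language Y.
Hypothesis Ymin : forall Z, is_subshift Z ->
  expand alpha @` language X `<=` language Z -> Y `<=` Z.

Definition expanded (s : seq (option A)) :=
  exists2 u, lang X u & infix s (subst exp_letter u).

(** This subshift contains the expansions of all words of [X], so by minimality it contains [Y] and
    bounds its language from above. *)
Definition expanded_points : set (biseq (option A)) :=
  [set y | forall i n, expanded (seg y i n)].

(** Let [u] occur in a point [x] of [X]. Expand ever longer segments of [x] around this occurrence,
    placing the expansion of [u] at position 0; a cluster point of these bisequences is as
    required. *)
Lemma expanded_exists u : lang X u ->
  exists2 y, expanded_points y & seg y 0 (size (subst exp_letter u)) = subst exp_letter u.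
Proof.
case=> x [i [Xx uE]]; set n := size u in uE; set U := subst exp_letter u.
pose l k := subst exp_letter (seg x (i - k%:Z)%R k).
pose r k := subst exp_letter (seg x (i + n%:Z)%R k).
pose W k := l k ++ U ++ r k.
have En a : exp_letter a <> [::] by rewrite /exp_letter; case: ifP.
have lk k : (k <= size (l k))%N by rewrite -{1}(size_seg x (i - k%:Z)%R k) size_subst.
have rk k : (k <= size (r k))%N by rewrite -{1}(size_seg x (i + n%:Z)%R k) size_subst.
have WE k : W k = subst exp_letter (seg x (i - k%:Z)%R (k + (n + k))).
  rewrite seg_cat subrK seg_cat !subst_cat -/(l k) -/(r k); congr (_ ++ _ ++ _).
  by rewrite /U uE.
(* Outside the expanded segment the values are junk, from the default of [nth] and from the absolute
   value; [yE] only concerns positions inside. *)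
pose y k : biseq (option A) := fun j => nth None (W k) `|(j + (size (l k))%:Z)%R|%N.
have yE k j m : (`|j| <= k)%N -> (j + m%:Z <= (size U)%:Z + k%:Z)%R ->
    seg (y k) j m = take m (drop `|(j + (size (l k))%:Z)%R|%N (W k)).
  move=> jk jm; rewrite -(map_nth_iota None); last first.
    rewrite /W !size_cat; move: (lk k) (rk k) jm.
    by set a := size (l k); set c := size (r k); set d := size U; lia.
  rewrite -[X in iota X](addn0) iotaDl -map_comp; apply: eq_map => d /=.
  by rewrite /y; congr nth; move: (lk k); set a := size (l k); lia.
have [z zP] := biseq_cluster y.
have zseg j m k0 : exists2 k, (k0 <= k)%N & seg z j m = seg (y k) j m.
  have [k kk ka] := zP (`|j| + m)%N k0; exists k => //.
  by apply: seg_eq => d dm; rewrite ka //; lia.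
exists z.
  move=> j m; have [k kk ->] := zseg j m (`|j| + m)%N.
  rewrite yE; [|by lia..].
  exists (seg x (i - k%:Z)%R (k + (n + k))); first exact: langP.
  by rewrite -WE; apply: infix_trans (infix_take _ _) (infix_drop _ _).
have [k _ ->] := zseg 0%R (size U) 0%N; rewrite yE ?add0r //; last by lia.
by rewrite /W drop_size_cat // take_size_cat.
Qed.

Lemma languageE (C : choiceType) (Z : set (biseq C)) (w : word C) :
  language Z w <-> lang Z w.
Proof. by []. Qed.

Lemma expanded_subshift : is_subshift expanded_points.
Proof.
have ex_shift i y : expanded_points y -> expanded_points (shift i y).
  by move=> ey j n; rewrite seg_shift.
split.
- have [[x Xx] _ _] := subX; have [|y ey _] := @expanded_exists [::].
    exact: (langP 0%R 0%N Xx).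
  by exists y.
- move=> z clz i n; have [y [ey yz]] := clz _ (nbhs_seg z i n).
  by rewrite -yz; exact: ey.
- apply/seteqP; split=> [_ [y ey <-]|y ey]; first exact: (ex_shift 1%R).
  exists (shift (-1)%R y); first exact: ex_shift.
  by rewrite -[LHS]/(shift 1 _) shiftD subrr shift0.
Qed.

Lemma lang_expanded w : lang Y w -> expanded w.
Proof.
case=> y [i [Yy ->]]; suff : expanded_points y by apply.
apply: Ymin Yy; first exact: expanded_subshift.
move=> _ [u /languageE Xu <-]; apply/languageE; rewrite expandE.
by have [z ez <-] := expanded_exists Xu; exact: langP.
Qed.

Lemma lang_expand u : lang X u -> lang Y (subst exp_letter u).
Proof.
move=> Xu; have [u0|[w wE]] : u = [::] \/ exists w : word A, wseq w = u.
  by case: (u) => [|a u']; [left|right; apply: word_of_seq].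
  by rewrite u0; have [[y Yy] _ _] := subY; exact: (langP 0%R 0%N Yy).
rewrite -wE -expandE; apply/languageE/XY; exists w => //.
by apply/languageE; rewrite wE.
Qed.

Lemma expand_transduces :
  transduces (lang X) (lang Y) 1 2 (memless exp_letter).
Proof.
split=> // p w _; rewrite run_memless.
  move=> Xpw; apply: lang_expand; apply: (pl_infix (lang_prolongable X)) Xpw.
  exact: suffix_infix.
move=> w2 _ ew; have := @size_subst _ _ exp_letter w; rewrite ew leqNgt.
rewrite (leq_trans _ w2) // => /(_ _)/negP; apply=> //.
by move=> a; rewrite /exp_letter; case: ifP.
Qed.

Lemma lang_compatible w : lang Y w -> sorted compatible w.
Proof.
by case/lang_expanded=> u _ wu; exact: infix_sorted wu (exp_compatible u).
Qed.

(** Contraction outputs nothing only on [alpha], and the letter after [alpha] is [None], which has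
    an output; hence the gap 2. *)
Lemma contract_transduces :
  transduces (lang Y) (lang X) 1 2 (memless contract_letter).
Proof.
split=> // p w _; rewrite run_memless.
  case/lang_expanded=> u Xu pwu; apply: (pl_infix (lang_prolongable X)) Xu.
  rewrite -(contract_expand u); apply: infix_subst; apply: infix_trans pwu.
  exact: suffix_infix.
move=> w2 /lang_compatible/cat_sorted2[_].
case: w w2 => // c [|d w] // _ /= /andP[cd _].
rewrite !subst_cons; case: c cd => [a|//]; rewrite /compatible /=.
case: (eqVneq a alpha) => [->|//]; rewrite eqxx => /eqP/esym/eqP -> //.
Qed.

Lemma expand_delays :
  delays (lang X) 1 (memless exp_letter) (memless contract_letter) (fun _ => [::]).
Proof.
split=> // [q|q z a _ _ _]; first exact: suffix0s.
by rewrite run_memless contract_exp_letter.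
Qed.

(** A final [alpha] has produced no output yet, since contraction waits for its companion letter. *)
Definition pending (q : seq (option A)) : seq (option A) :=
  if last None q == Some alpha then [:: Some alpha] else [::].

Lemma contract_delays :
  delays (lang Y) 1 (memless contract_letter) (memless exp_letter) pending.
Proof.
split.
- move=> q; rewrite /pending; case/lastP: q => // q c.
  by rewrite -cats1 lastn_size // last_cat.
- move=> q; rewrite /pending; case: eqP; last by rewrite suffix0s.
  case/lastP: q => // q c; rewrite last_rcons => ->.
  by rewrite -cats1 suffix_suffix.
move=> q z a q1 _; rewrite -rcons_cat => /lang_compatible.
have : (0 < size (q ++ z))%N by rewrite size_cat addn_gt0 q1.
case/lastP: (q ++ z) => // s c _; rewrite -!cats1 -catA /= => /cat_sorted2[_] /=.
rewrite andbT /compatible => /eqP ca.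
rewrite run_memless /pending !last_cat /= ca {ca} /memless.
case: a => [a|] /=; last by rewrite /subst /= /exp_letter eqxx.
case: (eqVneq a alpha) => [->|aN]; first by rewrite eqxx.
have -> : (Some a == Some alpha) = false by apply/eqP => -[/eqP]; rewrite (negPf aN).
by rewrite /subst /= /exp_letter (negPf aN).
Qed.

Lemma expand_linked : linked (lang X) (lang Y).
Proof.
exists 1%N, 2%N, (memless exp_letter), (memless contract_letter), (fun _ => [::]), pending.
split; [exact: expand_transduces|exact: contract_transduces|exact: expand_delays|].
exact: contract_delays.
Qed.

End SymbolExpansion.

(** * Flow equivalence *)

Section Invariants.
Variable V : semigroup_class.
Hypotheses (pvV : pseudovariety V) (monV : monoidal V) (LSlV : subclass LSl V).
Hypothesis VD : forall S, V S <-> pv_semidirect V DD S.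

Lemma closure_languageE (X : subshift) (u : freepro V (alphabet X)) :
  closure (@freepro_word V _ @` language (points X)) u <->
  limits true (lang (points X)) [::] [::] u.
Proof.
rewrite (closure_words pvV); split=> [H n r|H r].
  by have [w [Lw uw]] := H r; exists w; rewrite //= cats0.
by have [w] := H 0%N r; rewrite /= cats0 => Lw uw; exists w.
Qed.

(** The word [x] occurs as a suffix, as a prefix, strictly inside or as the whole word. One of these
    cases recurs at every precision, and compactness passes it to the limit. *)
Lemma frequently_infix (A : finType) (u : freepro V A) (x : word A) :
  (forall r, exists2 w, approx r u w & infix x w) -> Jle u (freepro_word V x).
Proof.
move=> H; apply: contrapT => nJ.
have N (P : word A -> Prop) : ~ (forall r, exists2 w, approx r u w & P w) ->
    near_words u (fun w => ~ P w).
  move=> /existsNP[r nP]; exists r => w uw Pw; apply: nP; by exists w.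
have n1 : near_words u (fun w => ~ exists y, w = y * x :> word A).
  apply: N => P; apply: nJ; have [|p ->] := @split_right _ pvV _ u (freepro_word V x).
    by move=> r; have [w uw [y wE]] := P r; exists y, x => //; rewrite -wE.
  exact: Jle_mull.
have n2 : near_words u (fun w => ~ exists y, w = x * y :> word A).
  apply: N => P; apply: nJ; have [|p ->] := @split_left _ pvV _ u (freepro_word V x).
    by move=> r; have [w uw [y wE]] := P r; exists y, x => //; rewrite -wE.
  exact: Jle_mulr.
have n3 : near_words u (fun w => ~ exists y z, w = y * x * z :> word A).
  apply: N => P; apply: nJ; have [|p [q ->]] := @split_middle _ pvV _ u (freepro_word V x).
    by move=> r; have [w uw [y [z wE]]] := P r; exists y, z, x => //; rewrite -wE.
  exact: Jle_mul.
have n4 : near_words u (fun w => ~ w = x).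
  apply: N => P; apply: nJ; suff -> : u = freepro_word V x by exact: Jle_refl.
  by apply: freepro_eq => r; have [w uw wx] := P r; exists x; rewrite -{1}wx.
have [r nP] := near_and pvV (near_and pvV n1 n2) (near_and pvV n3 n4).
have [w /nP[[w1 w2] [w3 w4]] /infixP[p [s wE]]] := H r.
have inj (y z : word A) : wseq y = wseq z -> y = z by exact: val_inj.
case: p s wE => [|a p] [|c s] wE.
- by apply: w4; apply: inj; rewrite wE cats0.
- apply: w2; exists (@Word _ (c :: s) isT); exact: inj.
- by apply: w1; exists (@Word _ (a :: p) isT); apply: inj; rewrite wE cats0.
- apply: w3; exists (@Word _ (a :: p) isT), (@Word _ (c :: s) isT).
  by apply: inj; rewrite wE /= -catA.
Qed.

(** All words near [u] have the same factors of length at most [n], which are therefore factors of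
    [u] by [frequently_infix]. Conversely a word that is a factor of [u] inherits local membership
    at the order of its own length. *)
Lemma mirageE (X : subshift) (u : freepro V (alphabet X)) :
  mirage V X u <-> limits false (lang (points X)) [::] [::] u.
Proof.
have plX := lang_prolongable (points X).
split=> [Mu n r|lim x ux].
  have [r' r'P] := rec_infix pvV monV LSlV VD (alphabet X) n.
  have [t [tr tr']] := vcong_meet pvV r r'; have [w uw] := approx_ex t u.
  exists w; last exact: approx_sub uw.
  rewrite cats0 => x xw xn.
  have [->|/eqP/word_of_seq[x' x'E]] := eqVneq x [::].
    by have [[y Xy] _ _] := subshiftP X; exact: (langP 0%R 0%N Xy).
  rewrite -x'E in xw xn *; apply: Mu; apply: frequently_infix => s.
  have [s' [s's s'r']] := vcong_meet pvV s r'; have [z uz] := approx_ex s' u.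
  exists z; first exact: approx_sub uz.
  rewrite -(r'P w z) //; apply: approx_cong (approx_sub tr' uw) _.
  exact: approx_sub uz.
have ux_loc := near_limits pvV monV LSlV VD plX (size x) lim.
have [r /(_ x)] : near_words (freepro_word V x) (fun w => loc (lang (points X)) (size x) w).
  apply: near_Jle (rec_loc pvV monV LSlV VD _ _) _ ux ux_loc => //.
  by move=> y z yz; exact: loc_infix.
by move=> /(_ (approx_word _ _)); exact: lang_loc.
Qed.

(** The J-class of [e] lies in the shadow, so it contains a limit of words of the language; and the
    J-class of any such limit lies in the shadow, hence above [e]. *)
Lemma shadow_minimal (X : subshift) J (e : freepro V (alphabet X)) :
  min_Jclass (shadow V X) J -> J e -> idem e ->
  minimal_idem true (lang (points X)) e.
Proof.
case=> _ Jsub Jmin Je ee; split=> // [|v /closure_languageE clv].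
  have [_ [[a ->] [ae ea] [w [[aw wa] /closure_languageE limw]]]] := Jsub _ Je.
  by exists w => //; exact: Jle_trans wa ae.
apply: (Jmin (Jclass v)) => //; [by exists v| |by split; exact: Jle_refl].
move=> u vu; exists (Jclass v); split=> //; first by exists v.
by exists v; split=> //; split; exact: Jle_refl.
Qed.

Lemma mirage_minimal (X : subshift) J (e : freepro V (alphabet X)) :
  min_Jclass (mirage V X) J -> J e -> idem e ->
  minimal_idem false (lang (points X)) e.
Proof.
case=> _ Jsub Jmin Je ee; split=> // [|v /mirageE Mv].
  by exists e; [exact/mirageE/Jsub|exact: Jle_refl].
apply: (Jmin (Jclass v)) => //; [by exists v| |by split; exact: Jle_refl].
by move=> u [vu uv] w uw; apply: Mv; exact: Jle_trans vu uw.
Qed.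

Lemma minimal_idem_Jle (A : finType) b (L : seq A -> Prop) (e f : freepro V A) :
  minimal_idem b L e -> minimal_idem b L f -> Jle e f.
Proof. by move=> [_ _ emin] [_ [w /emin ew wf] _]; exact: Jle_trans ew wf. Qed.

Definition transfers (X Y : subshift) := forall b (e : freepro V (alphabet X)),
  minimal_idem b (lang (points X)) e -> exists f : freepro V (alphabet Y),
    minimal_idem b (lang (points Y)) f /\ cont_iso (unit_group e) (unit_group f).

Lemma linked_transfers (X Y : subshift) :
  linked (lang (points X)) (lang (points Y)) -> transfers X Y.
Proof.
move=> XY b e; have [[x _] _ _] := subshiftP X; have [[y _] _ _] := subshiftP Y.
apply: (minimal_idem_iso pvV monV LSlV VD (x 0%R : alphabet X) (y 0%R : alphabet Y)) XY;
  exact: lang_prolongable.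
Qed.

Lemma flow_equivalent_transfers (X Y : subshift) :
  flow_equivalent X Y -> transfers X Y /\ transfers Y X.
Proof.
elim=> {X Y} [X Y XY|X|X Y _ [XY YX]|X Y Z _ [XY YX] _ [YZ ZY]].
- suff XYl : linked (lang (points X)) (lang (points Y)).
    by split; apply: linked_transfers => //; exact: linked_sym.
  case: XY => [|[]]; first exact: conjugate_linked.
  by move=> A alpha X' Y' sX sY XY' Ymin; exact: expand_linked XY' Ymin.
- by split=> b e emin; exists e; split=> //; exact: cont_iso_refl.
- by split.
- split=> b e emin.
    have [f [fmin ef]] := XY b e emin; have [g [gmin fg]] := YZ b f fmin.
    by exists g; split=> //; exact: cont_iso_trans ef fg.
  have [f [fmin ef]] := ZY b e emin; have [g [gmin fg]] := YX b f fmin.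
  by exists g; split=> //; exact: cont_iso_trans ef fg.
Qed.

(** The transferred idempotent need not be [f], but both are minimal, hence J-equivalent. *)
Lemma transfers_iso (X Y : subshift) b (e : freepro V (alphabet X))
    (f : freepro V (alphabet Y)) : transfers X Y ->
  minimal_idem b (lang (points X)) e -> minimal_idem b (lang (points Y)) f ->
  profinite_iso (unit_group e) (unit_group f).
Proof.
move=> XY emin fmin; have [f' [f'min ef']] := XY b e emin.
apply: cont_iso_profinite; apply: cont_iso_trans ef' _.
have [ff _ _] := fmin; have [ff' _ _] := f'min.
apply: (idem_Jclass_iso pvV) => //.
  exact: minimal_idem_Jle f'min fmin.
exact: minimal_idem_Jle fmin f'min.
Qed.

End Invariants.

Theorem corollary6p12 (V : semigroup_class)
    (pvV : pseudovariety V) (monV : monoidal V) (LSlV : subclass LSl V)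
    (VD : forall S, V S <-> pv_semidirect V DD S)
    (X Y : subshift) (irrX : irreducible X) (irrY : irreducible Y)
    (XY : flow_equivalent X Y) :
  (forall G H, shadow_group V X G -> shadow_group V Y H ->
     profinite_iso G H) /\
  (forall G H, mirage_group V X G -> mirage_group V Y H ->
     profinite_iso G H).
Proof.
have [XYt _] := flow_equivalent_transfers pvV monV LSlV VD XY.
split=> G H [J [Jmin /maximal_subgroupE[e [ee ->]] GJ]];
  case=> J' [J'min /maximal_subgroupE[f [ff ->]] HJ'].
- have emin := shadow_minimal pvV Jmin (GJ _ (unit_group1 ee)) ee.
  have fmin := shadow_minimal pvV J'min (HJ' _ (unit_group1 ff)) ff.
  exact: (transfers_iso pvV XYt emin fmin).
- have emin := mirage_minimal pvV monV LSlV VD Jmin (GJ _ (unit_group1 ee)) ee.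
  have fmin := mirage_minimal pvV monV LSlV VD J'min (HJ' _ (unit_group1 ff)) ff.
  exact: (transfers_iso pvV XYt emin fmin).
Qed.
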